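(* The following Gauss diagram formulas compute the Milnor invariants $\mu_{23,1}$ and $\mu_{234,1}$. Denote by $[p_1s_1,\,p_2s_2,\dots]$ the arrow diagram whose arrows are, listed from top to bottom (i.e. in the order in which their endpoints appear along the strings), $p_1\to s_1$, $p_2\to s_2$, and so on, where $p\to s$ is an arrow with tail on the $p$-th and head on the $s$-th string. For an ordered (classical or virtual) tangle $L$ on $3$ strings with Gauss diagram $G$, $$\mu_{23,1}(L)=\big\langle [32,21]+[21,31]-[23,31],\,G\big\rangle .$$ For an ordered (classical or virtual) tangle $L$ on $4$ strings with Gauss diagram $G$, $$\begin{aligned}\mu_{234,1}(L)=\big\langle\,&[21,31,41]-[21,34,41]+[34,24,41]+[32,21,41]-[32,24,41]-[23,31,41]\\&+[21,43,31]-[23,43,31]-[43,23,31]+[23,34,41]+[32,42,21]+[43,32,21]-[34,42,21],\ G\big\rangle .\end{aligned}$$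
   Context: **Tangles and Gauss diagrams.** Let $D^2$ be a disk in the $xy$-plane with prescribed interior points $p_1,p_2,\dots$ on the $x$-axis, and $C=D^2\times[0,1]$. An ordered, oriented $(k,l)$-tangle is an ordered collection of $n=\frac12(k+l)$ disjoint oriented intervals (strings) properly embedded in $C$ with endpoints in $\{p_i\}_{i=1}^k\times\{1\}\cup\{p_i\}_{i=1}^l\times\{0\}$ (no closed components), up to oriented isotopy of $C$ fixed on the boundary. The Gauss diagram of a tangle diagram (generic projection to the $xz$-plane) is an ordered collection of $n$ oriented intervals with the two preimages of each crossing joined by an arrow from the over-passing to the under-passing point, carrying the sign $\pm1$ (local writhe) of the crossing. A virtual tangle is an equivalence class of abstract Gauss diagrams (any ordered collection of $n$ oriented intervals with signed arrows) modulo the Reidemeister moves of Gauss diagrams. Strings are drawn as vertical lines oriented downwards, ordered from left to right. **Pairing.** An arrow diagram on $n$ strings is an ordered set of $n$ oriented intervals with several unsigned arrows connecting pairs of distinct points on them, up to orientation-preserving diffeomorphism of the intervals (only the order of arrow endpoints on each string matters). For an arrow diagram $A$ and a Gauss diagram $G$ on $n$ strings, $\langle A,G\rangle=\sum_{\phi:A\to G}\operatorname{sign}(\phi)$, where $\phi$ runs over embeddings mapping the $i$-th string to the $i$-th string and arrows to arrows, preserving orientations, and $\operatorname{sign}(\phi)=\prod_{a\in A}\operatorname{sign}(\phi(a))$; the pairing is extended linearly in $A$. **Milnor's $\mu$-invariants.** For a classical tangle let $\pi=\pi_1(C\setminus L)$; for a virtual tangle let $\pi$ be the (upper) tangle group of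 its Gauss diagram. In both cases $\pi$ has the Wirtinger presentation read off a Gauss diagram: generators are the arcs, i.e. the segments into which the arrowheads cut the strings; for each arrow of sign $\varepsilon$ with tail on the arc $a$ and head separating consecutive arcs $b$ (incoming) and $c$ (outgoing), there is the relation $c=a^{-\varepsilon}ba^{\varepsilon}$. The canonical meridian $m_i$ is the generator of the first arc of the $i$-th string (a small loop around the starting point of $L_i$ with $\operatorname{lk}(m_i,L_i)=+1$). The canonical parallel $l_j$ (a pushed-off copy of $L_j$ closed up along the boundary of $C$, with $\operatorname{lk}(l_j,L_j)=0$) is the product $a_1^{\varepsilon_1}\cdots a_s^{\varepsilon_s}$, where $a_1,\dots,a_s$ are the arcs carrying the tails of the arrows with heads on the $j$-th string, in the order in which the heads are met along the $j$-th string, and $\varepsilon_t$ are their signs, multiplied by the power of $m_j$ making the total exponent of $j$-th string arcs zero (this power does not affect the coefficients below with $j\notin\{i_1,\dots,i_r\}$). The reduced group $\tilde\pi$ is the quotient of $\pi$ by the relations $[m_i,w^{-1}m_iw]=1$ for all $i$ and all $w\in\pi$; similarly $\tilde F$ for the free group $F$ on $x_1,\dots,x_n$ (with $x_i$ in place of $m_i$). The map $x_i\mapsto m_i$ induces an isomorphism $\tilde F\cong\tilde\pi$. Let $\tilde Z$ be the quotient of the ring $\mathbb Z[[X_1,\dots,X_n]]$ of power series in non-commuting variables by the two-sided ideal generated by all monomials in which some $X_i$ occurs more than once. The Magnus expansion $x_i\mapsto 1+X_i$, $x_i^{-1}\mapsto 1-X_i+X_i^2-\cdots$ induces a ring homomorphism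 $\theta_L:\mathbb Z\tilde\pi\cong\mathbb Z\tilde F\to\tilde Z$. The invariants $\mu_{i_1\dots i_r,j}(L)$ (distinct indices $i_1,\dots,i_r,j$) are defined by $\theta_L(l_j)=\sum\mu_{i_1\dots i_r,j}X_{i_1}\cdots X_{i_r}$. *)

(* Defs.v *)
From mathcomp Require Import all_boot all_order all_algebra.
From mathcomp Require Import boolp classical_sets.

Set Implicit Arguments.
Unset Strict Implicit.
Unset Printing Implicit Defensive.

Import GRing.Theory.
Local Open Scope ring_scope.

(* An arrow [a] has the two endpoints [tail_of a] and [head_of a].  Only the   *)
(* order of the endpoints on a string matters, so a string is the list of the *)
(* endpoints met when it is followed from top to bottom; [on e] is the string *)
(* carrying the endpoint [e].                                                 *)
Record arrow_diagram (n : nat) := ArrowDiagram {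
  arrow : finType;
  on : arrow * bool -> 'I_n;
  strand : 'I_n -> seq (arrow * bool);
  strand_uniq : forall i, uniq (strand i);
  mem_strand : forall i e, (e \in strand i) = (on e == i) }.

Definition tail_of {T : Type} (a : T) : T * bool := (a, false).
Definition head_of {T : Type} (a : T) : T * bool := (a, true).

Record gauss_diagram (n : nat) := GaussDiagram {
  arrows_of :> arrow_diagram n;
  positive : arrow arrows_of -> bool }.

Definition sign n (G : gauss_diagram n) (a : arrow G) : int :=
  if positive a then 1 else -1.

(* Since the strands of [G] have no repetition, [subseq] says exactly that    *)
(* [phi] preserves the string and the relative order of all endpoints.        *)
Definition embedding n (A B : arrow_diagram n)
    (phi : {ffun arrow A -> arrow B}) : bool :=
  injectiveb phi &&
  [forall i, subseq [seq (phi e.1, e.2) | e <- strand A i] (strand B i)].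

Definition pairing1 n (A : arrow_diagram n) (G : gauss_diagram n) : int :=
  \sum_(phi : {ffun arrow A -> arrow G} | embedding phi)
     \prod_(a : arrow A) sign (phi a).

(* The first argument is a formal integer combination of arrow diagrams. *)
Definition pairing n (A : seq (int * arrow_diagram n)) (G : gauss_diagram n) :
  int := \sum_(t <- A) t.1 * pairing1 t.2 G.

(* The diagram [p_1 s_1, p_2 s_2, ...]: arrows p_k -> s_k listed from top to  *)
(* bottom.                                                                    *)
Section ArrowList.
Variables (n : nat) (s : seq ('I_n * 'I_n)).

Definition list_on (e : 'I_(size s) * bool) : 'I_n :=
  let ps := tnth (in_tuple s) e.1 in if e.2 then ps.2 else ps.1.

Definition list_endpoints : seq ('I_(size s) * bool) :=
  [seq (k, b) | k <- enum 'I_(size s), b <- [:: false; true]].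

Definition list_strand (i : 'I_n) := [seq e <- list_endpoints | list_on e == i].

Fact list_strand_uniq i : uniq (list_strand i).
Proof.
by apply/filter_uniq/allpairs_uniq; rewrite ?enum_uniq// => -[? ?] [? ?].
Qed.

Fact mem_list_strand i e : (e \in list_strand i) = (list_on e == i).
Proof.
rewrite mem_filter; case: eqP => //= _; apply/allpairsP; exists e.
by rewrite mem_enum; case: e => k [].
Qed.

Definition arrow_list : arrow_diagram n :=
  ArrowDiagram list_strand_uniq mem_list_strand.
End ArrowList.

(* Strings are numbered from 1 in the formulas. *)
Definition string {n} (k : nat) : 'I_n.+1 := inord k.-1.

Definition diagram {n} (s : seq (nat * nat)) : arrow_diagram n.+1 :=
  arrow_list [seq (string ps.1, string ps.2) | ps <- s].

(* Group words: (x, true) stands for x and (x, false) for its inverse. *)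
Definition word (X : Type) := seq (X * bool).

Definition winv X (u : word X) : word X := rev [seq (x.1, ~~ x.2) | x <- u].

Definition wconj X (u w : word X) : word X := winv w ++ u ++ w.

Definition wcomm X (u v : word X) : word X := winv u ++ winv v ++ u ++ v.

Definition wpow X (x : X) (k : int) : word X := nseq `|k|%N (x, 0 <= k).

(* Equality of two words in the group presented by generators X and relations *)
(* u = v for all (u, v) in R.                                                 *)
Inductive pres_eq X (R : word X -> word X -> Prop) : word X -> word X -> Prop :=
| pres_rel u v : R u v -> pres_eq R u v
| pres_cancel x b : pres_eq R [:: (x, b); (x, ~~ b)] [::]
| pres_refl u : pres_eq R u u
| pres_sym u v : pres_eq R u v -> pres_eq R v u
| pres_trans u v w : pres_eq R u v -> pres_eq R v w -> pres_eq R u w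
| pres_mul u u' v v' :
    pres_eq R u u' -> pres_eq R v v' -> pres_eq R (u ++ v) (u' ++ v').

Section TangleGroup.
Variables (n : nat) (G : gauss_diagram n).

(* An arc is named by its starting point: [inl i] starts at the top of the    *)
(* i-th string, [inr a] just after the head of the arrow a.                   *)
Definition arc : Type := 'I_n + arrow G.

(* The arc carrying the endpoint e; if e is itself a head, the arc ending at  *)
(* e.                                                                         *)
Definition arc_at (e : arrow G * bool) : arc :=
  let st := strand G (on e) in
  last (inl (on e)) [seq inr d.1 | d <- take (index e st) st & d.2].

Definition meridian (i : 'I_n) : arc := inl i.

Definition wirtinger (u v : word arc) : Prop := exists a : arrow G,
  u = [:: (inr a, true)] /\
  v = wconj [:: (arc_at (head_of a), true)]
            [:: (arc_at (tail_of a), positive a)].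

(* The relations of the reduced tangle group: those of the tangle group, and  *)
(* [m_i, w^-1 m_i w] = 1 for all i and w.                                     *)
Definition reduced_rel (u v : word arc) : Prop :=
  wirtinger u v \/
  exists (i : 'I_n) (w : word arc),
    let m := [:: (meridian i, true)] in u = wcomm m (wconj m w) /\ v = [::].

Definition red_group_eq : word arc -> word arc -> Prop := pres_eq reduced_rel.

Definition parallel_word (j : 'I_n) : word arc :=
  [seq (arc_at (tail_of e.1), positive e.1) | e <- strand G j & e.2].

Definition self_writhe (j : 'I_n) : int :=
  \sum_(a : arrow G | (on (tail_of a) == j) && (on (head_of a) == j)) sign a.

Definition parallel (j : 'I_n) : word arc :=
  parallel_word j ++ wpow (meridian j) (- self_writhe j).

(* The homomorphism x_i |-> m_i from the free group on 'I_n. *)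
Definition at_meridians (w : word 'I_n) : word arc :=
  [seq (meridian x.1, x.2) | x <- w].

(* Inverse of the isomorphism induced by [at_meridians] between the reduced   *)
(* free group and the reduced tangle group: a word in the x_i representing    *)
(* the preimage of g.                                                         *)
Definition red_preimage (g : word arc) : word 'I_n :=
  xget [::] [set w | red_group_eq (at_meridians w) g].

End TangleGroup.

(* Power series in the non-commuting variables X_i, i : 'I_n, with integer    *)
(* coefficients: the list [:: i_1; ...; i_r] stands for X_{i_1}...X_{i_r}.    *)
Definition ncseries (n : nat) := seq 'I_n -> int.

Definition nc_one n : ncseries n := fun I => (nilp I)%:R.

Definition nc_mul n (f g : ncseries n) : ncseries n :=
  fun I => \sum_(k < (size I).+1) f (take k I) * g (drop k I).

(* 1 + X_i for b = true, 1 - X_i + X_i^2 - ... for b = false. *)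
Definition magnus_letter n (x : 'I_n * bool) : ncseries n := fun I =>
  if x.2 then ((I == [::]) || (I == [:: x.1]))%:R
  else if all (pred1 x.1) I then (-1) ^+ size I else 0.

Definition magnus n (w : word 'I_n) : ncseries n :=
  foldr (fun x f => nc_mul (magnus_letter x) f) (@nc_one n) w.

(* The ideal generated by the monomials in which some variable is repeated    *)
(* consists of the series supported on such monomials; a class modulo this    *)
(* ideal is represented by its unique element vanishing on all of them.       *)
Definition mod_repeats n (f : ncseries n) : ncseries n :=
  fun I => if uniq I then f I else 0.

Definition theta n (G : gauss_diagram n) (g : word (arc G)) : ncseries n :=
  mod_repeats (magnus (red_preimage g)).

(* mu_{i_1 ... i_r, j}, meaningful for distinct indices. *)
Definition milnor n (G : gauss_diagram n) (I : seq 'I_n) (j : 'I_n) : int :=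
  theta (parallel G j) I.

(* Main.v *)
(** The Wirtinger relation makes every arc of the [i]-th string a conjugate of
    [m_i] by the word [P] read off the arrowheads above it.  Modulo the [k]-th
    term of a lower-central-type filtration [P] is a word in the meridians, so
    the arc is one modulo the next term; in the reduced group the filtration
    stops after [n] steps, so the meridians generate it.  Conversely, for
    distinct [I = i_1 ... i_r], sending [m_i] to the unipotent matrix
    [1 + E_(a, a+1)] if [i = i_(a+1)], and to [1] if [i] is not in [I], extends
    to the reduced tangle group: an arc must go to [1 + Q X P], where [P] is
    the product over the heads above it and [Q = P^-1], and this recursion has
    a solution because [X] is strictly triangular.  The corner entry of a word
    in the meridians is the coefficient of [I] in its Magnus expansion, hence
    the Milnor number of [I, j] is the corner entry of the image of [l_j].
    Expanding it gives sums over trees of arrows, one for each diagram. *)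
Require Import Defs.
From HB Require Import structures.
From mathcomp Require Import all_boot all_order all_algebra.
From mathcomp Require Import boolp classical_sets.
From mathcomp Require Import zify ring.

(* [arc] would otherwise be the one of [path]. *)
Import Defs.

Set Implicit Arguments.
Unset Strict Implicit.
Unset Printing Implicit Defensive.

(** * The reduced tangle group is generated by the meridians *)

Section PresentedGroup.
Local Open Scope group_scope.
Local Open Scope quotient_scope.
Variables (X : choiceType) (R : word X -> word X -> Prop).

Definition pres_eqb : rel (word X) := fun u v => `[< pres_eq R u v >].

Lemma pres_eqb_equiv : equiv_class_of pres_eqb.
Proof.
split=> [u|u v|v u w]; first exact/asboolP/pres_refl.
  by apply/asboolP/asboolP; apply: pres_sym.
by move=> /asboolP uv /asboolP vw; apply/asboolP/(pres_trans uv).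
Qed.

Canonical pres_eqb_rel := EquivRelPack pres_eqb_equiv.

Definition presented := {eq_quot pres_eqb_rel}.

HB.instance Definition _ := Choice.on presented.

Definition class (u : word X) : presented := \pi_({eq_quot pres_eqb_rel}) u.

Lemma classP u v : class u = class v <-> pres_eq R u v.
Proof.
rewrite /class; split=> [/eqP|uv]; first by rewrite eqmodE => /asboolP.
by apply/eqP; rewrite eqmodE; apply/asboolP.
Qed.

Lemma class_eq u v : pres_eq R u v -> class u = class v.
Proof. by move/classP. Qed.

Lemma class_repr (x : presented) : class (repr x) = x.
Proof. exact: reprK. Qed.

Lemma winvK : involutive (@winv X).
Proof.
move=> u; rewrite /winv map_rev revK -map_comp -[RHS]map_id.
by apply: eq_map => -[x b] /=; rewrite negbK.
Qed.

Lemma winv_cat (u v : word X) : winv (u ++ v) = winv v ++ winv u.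
Proof. by rewrite /winv map_cat rev_cat. Qed.

Lemma pres_mulV u : pres_eq R (u ++ winv u) [::].
Proof.
elim: u => [|x u IHu]; first exact: pres_refl.
rewrite -cat1s winv_cat -!catA (catA u).
apply: pres_trans (pres_mul (pres_refl _ _) (pres_mul IHu (pres_refl _ _))) _.
by case: x => x b; apply: pres_cancel.
Qed.

(** [pres_eq] has no rule for inverses; this one follows by inserting [v v^-1] and cancelling. *)
Lemma pres_inv u v : pres_eq R u v -> pres_eq R (winv u) (winv v).
Proof.
move=> uv; have uVvV: pres_eq R (winv u ++ (v ++ winv v)) (winv v).
  rewrite catA -[X in pres_eq _ _ X]cat0s; apply: pres_mul (pres_refl _ _).
  have := pres_mulV (winv u); rewrite winvK; apply: pres_trans.
  by apply: pres_mul (pres_refl _ _) _; apply: pres_sym.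
apply: pres_trans uVvV; rewrite -[X in pres_eq _ X]cats0.
by apply: pres_mul (pres_refl _ _) _; apply/pres_sym/pres_mulV.
Qed.

Definition pmul (x y : presented) := class (repr x ++ repr y).
Definition pinv (x : presented) := class (winv (repr x)).

Lemma class_cat u v : class (u ++ v) = pmul (class u) (class v).
Proof. by apply/classP/pres_mul; apply/classP; rewrite class_repr. Qed.

Lemma class_winv u : class (winv u) = pinv (class u).
Proof. by apply/classP/pres_inv/classP; rewrite class_repr. Qed.

Lemma pmulA : associative pmul.
Proof.
move=> x y z; rewrite -(class_repr x) -(class_repr y) -(class_repr z).
by rewrite -!class_cat catA.
Qed.

Lemma pmul1g : left_id (class [::]) pmul.
Proof. by move=> x; rewrite -(class_repr x) -class_cat. Qed.

Lemma pmulg1 : right_id (class [::]) pmul.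
Proof. by move=> x; rewrite -(class_repr x) -class_cat cats0. Qed.

Lemma pmulgV : right_inverse (class [::]) pinv pmul.
Proof.
move=> x; rewrite -(class_repr x) -class_winv -class_cat.
exact/classP/pres_mulV.
Qed.

Lemma pmulVg : left_inverse (class [::]) pinv pmul.
Proof.
move=> x; rewrite -(class_repr x) -{2}[repr x]winvK -class_winv -class_cat.
exact/classP/pres_mulV.
Qed.

HB.instance Definition _ :=
  isGroup.Build presented pmulA pmul1g pmulg1 pmulVg pmulgV.

Lemma classM u v : class (u ++ v) = class u * class v.
Proof. exact: class_cat. Qed.

Lemma classV u : class (winv u) = (class u)^-1.
Proof. exact: class_winv. Qed.

Lemma classJ u v : class (wconj u v) = class u ^ class v.
Proof. by rewrite /wconj !classM classV. Qed.

Lemma class1 : class [::] = 1. Proof. by []. Qed.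

Lemma class_comm u v : class (wcomm u v) = [~ class u, class v].
Proof. by rewrite /wcomm !classM !classV. Qed.

End PresentedGroup.
Arguments class {X} R u.

Lemma pres_mono (X : Type) (R R' : word X -> word X -> Prop) u v :
    (forall u v, R u v -> pres_eq R' u v) ->
  pres_eq R u v -> pres_eq R' u v.
Proof.
move=> RR'; elim=> {u v} [u v|x b|u|u v _|u v w _ IHu _|u u' v v' _ IHu _].
- exact: RR'.
- exact: pres_cancel.
- exact: pres_refl.
- exact: pres_sym.
- exact: pres_trans IHu.
- exact: pres_mul.
Qed.

(** * The normal closure of one element *)

Section NormalClosure.
Local Open Scope group_scope.
Variables (T : groupType) (m : T).

Inductive normal_closure : T -> Prop :=
| normal_closure1 : normal_closure 1
| normal_closureM w x : normal_closure x -> normal_closure (m ^ w * x)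
| normal_closureVM w x : normal_closure x -> normal_closure ((m ^ w)^-1 * x).

Lemma ncM x y : normal_closure x -> normal_closure y -> normal_closure (x * y).
Proof.
elim=> [|w {}x _ IHx|w {}x _ IHx] ny; first by rewrite mul1g.
  by rewrite -(mulgA (m ^ w)); apply: normal_closureM; apply: IHx.
by rewrite -(mulgA (m ^ w)^-1); apply: normal_closureVM; apply: IHx.
Qed.

Lemma ncJ x y : normal_closure x -> normal_closure (x ^ y).
Proof.
elim=> [|w {}x _ IHx|w {}x _ IHx].
  by rewrite conj1g; apply: normal_closure1.
  by rewrite conjMg -conjgM; apply: normal_closureM.
by rewrite conjMg conjVg -conjgM; apply: normal_closureVM.
Qed.

Lemma nc_id w : normal_closure (m ^ w).
Proof. by rewrite -[_ ^ _]mulg1; apply/normal_closureM/normal_closure1. Qed.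

Lemma ncV x : normal_closure x -> normal_closure x^-1.
Proof.
elim=> [|w {}x _ IHx|w {}x _ IHx].
  by rewrite invg1; apply: normal_closure1.
  rewrite invgM; apply: ncM => //.
  by rewrite -[_^-1]mulg1; apply/normal_closureVM/normal_closure1.
by rewrite invgM invgK; apply: ncM (nc_id _).
Qed.

(** Two conjugates of [m] commute because they are simultaneous conjugates of [m] and of one
    conjugate of it; products follow factor by factor. *)
Lemma nc_commute :
  (forall w, commute m (m ^ w)) ->
  forall x y, normal_closure x -> normal_closure y -> commute x y.
Proof.
move=> mC; have mJC w z : commute (m ^ w) (m ^ z).
  have := congr1 (conjg^~ w) (mC (z * w^-1)); set u := m ^ (z * w^-1).
  by rewrite /= (conjMg m u) (conjMg u m) /u -conjgM mulgVK.
have mJ w y : normal_closure y -> commute (m ^ w) y.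
  elim=> [|z {}y _ IHy|z {}y _ IHy]; first exact: commute1.
    exact: commuteM.
  by apply: commuteM => //; apply: commuteV.
move=> x y + ny; elim=> [|w {}x _ IHx|w {}x _ IHx]; apply: commute_sym.
- exact: commute1.
- by apply: commuteM; apply: commute_sym => //; apply: mJ.
- by apply: commuteM; [apply/commuteV|]; apply: commute_sym => //; apply: mJ.
Qed.
End NormalClosure.

(** * Arcs as conjugates of meridians *)

Section Arcs.
Variables (n : nat) (G : gauss_diagram n).

Definition heads_before (e : arrow G * bool) : seq (arrow G) :=
  let st := strand G (on e) in [seq d.1 | d <- take (index e st) st & d.2].

Definition string_of (c : arc G) : 'I_n :=
  match c with inl i => i | inr a => on (head_of a) end.

(** The head at which the arc starts is included. *)
Definition heads_upto (c : arc G) : seq (arrow G) :=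
  match c with
  | inl _ => [::]
  | inr a => rcons (heads_before (head_of a)) a
  end.

(** Induction on the length [k] of a prefix of the strand: a tail changes nothing, while a head
    starts a new arc, and the heads above it are those among the first [k] endpoints. *)
Lemma heads_before_arc_at e :
  string_of (arc_at e) = on e /\ heads_upto (arc_at e) = heads_before e.
Proof.
rewrite /arc_at /heads_before; set st := strand G (on e).
have st_uniq : uniq st := strand_uniq _ _.
have on_st d : d \in st -> on d = on e by rewrite mem_strand => /eqP.
have: index e st <= size st by apply: index_size.
elim: (index e st) => [|k IHk] kst; first by rewrite take0.
have {IHk} [IHs IHh] := IHk (ltnW kst).
rewrite (take_nth e) // filter_rcons; set d := nth e st k.
case d_head: d.2 => //; rewrite !map_rcons last_rcons /=.
have -> : head_of d.1 = d by rewrite /head_of -d_head; case: (d).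
by rewrite on_st ?mem_nth // /heads_before on_st ?mem_nth // index_uniq.
Qed.

Lemma string_of_arc_at e : string_of (arc_at e) = on e.
Proof. by case: (heads_before_arc_at e). Qed.

Lemma heads_upto_arc_at e : heads_upto (arc_at e) = heads_before e.
Proof. by case: (heads_before_arc_at e). Qed.

Definition tail_letter (x : arrow G) : arc G * bool :=
  (arc_at (tail_of x), positive x).

(** Induction on the number of heads above the arc: the Wirtinger relation at its initial head adds
    one conjugating letter. *)
Lemma arc_conj (R : word (arc G) -> word (arc G) -> Prop) (c : arc G) :
    (forall u v, wirtinger u v -> R u v) ->
  pres_eq R [:: (c, true)] (wconj [:: (meridian G (string_of c), true)]
                                  [seq tail_letter x | x <- heads_upto c]).
Proof.
move=> RW; have [k] := ubnP (size (heads_upto c)).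
elim: k c => // k IHk [i|a] /= lt_k; first exact: pres_refl.
have lt_k1 : size (heads_upto (arc_at (head_of a))) < k.
  by move: lt_k; rewrite size_rcons heads_upto_arc_at.
have IH := IHk _ lt_k1.
apply/classP; have Wa : R _ _ := RW _ _ (ex_intro _ a (conj erefl erefl)).
rewrite (class_eq (pres_rel Wa)) !classJ (class_eq IH) classJ.
rewrite heads_upto_arc_at string_of_arc_at.
by rewrite map_rcons -cats1 classM conjgM.
Qed.

End Arcs.

(** * A filtration that stops after [n] steps *)

Section MeridiansGenerate.
Local Open Scope group_scope.
Variables (n : nat) (G : gauss_diagram n).

Let mer i : word (arc G) := [:: (meridian G i, true)].
Let red := class (@reduced_rel n G).

(* Also kills every element that lies in the normal closures of [k] distinct
   meridians.  With [k = 0] the quotient is trivial; with [k = n + 1] no relation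
   is added to those of the reduced group. *)
Definition lower_rel k (u v : word (arc G)) : Prop :=
  reduced_rel u v \/ v = [::] /\ exists S : {set 'I_n},
    (k <= #|S|)%N /\ forall i, i \in S -> normal_closure (red (mer i)) (red u).

Lemma lower_red k u v : red_group_eq u v -> pres_eq (lower_rel k) u v.
Proof.
by apply: pres_mono => {}u {}v uv; apply: pres_rel; left.
Qed.

Lemma meridian_commute i w : commute (red (mer i)) (red (mer i) ^ w).
Proof.
apply/commgP/eqP; rewrite -(class_repr w) -classJ -class_comm -class1.
by apply/classP/pres_rel; right; exists i, (repr w).
Qed.

Lemma arc_normal_closure (c : arc G) b :
  normal_closure (red (mer (string_of c))) (red [:: (c, b)]).
Proof.
have cP : normal_closure (red (mer (string_of c))) (red [:: (c, true)]).
  have cJ := @arc_conj n G (@reduced_rel n G) c (fun u v => @or_introl _ _).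
  by rewrite /red (class_eq cJ) classJ; apply: nc_id.
case: b => //; have -> : [:: (c, false)] = winv [:: (c, true)] by [].
by rewrite /red classV; apply: ncV.
Qed.

(* For [y] on the [i]-th string and [u] in the normal closures indexed by [S],
   the commutator of [y] and [u] lies in those indexed by [i |: S]; if [i] is
   already in [S] it is trivial, since the normal closure of [m_i] is abelian. *)
Lemma lower_conj k u v : pres_eq (lower_rel k) u v ->
  forall x, pres_eq (lower_rel k.+1) (wconj x u) (wconj x v).
Proof.
elim=> {u v} [u v [uv x|[-> [S [leS uS]]] x]|y b x|u x|u v _ IH x
  |u v w _ IHv _ IHw x|u u' v v' _ IHu _ IHv x].
- have /(lower_red k.+1)/classP uv' : red_group_eq u v by apply: pres_rel.
  by apply/classP; rewrite !classJ uv'.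
- apply/classP; rewrite !classJ class1 conjg1.
  (* Conjugation by the killed word [u] is shown to fix [x] letter by letter. *)
  elim: x => [|[c b] x IHx]; first by rewrite conj1g.
  rewrite -cat1s classM conjMg {}IHx; congr (_ * _).
  have yN := arc_normal_closure c b; set i := string_of c in yN.
  have red_lower := lower_red k.+1; set y : word (arc G) := [:: (c, b)].
  have [iS|iNS] := boolP (i \in S).
    rewrite -classJ; apply/classP/red_lower/classP; rewrite classJ.
    apply/conjg_fixP/commgP.
    exact: nc_commute (meridian_commute i) _ _ yN (uS i iS).
  rewrite -classJ; apply/(mulgI (class _ y)^-1); rewrite mulVg -classV -classM.
  apply/classP/pres_rel; right; split=> //; exists (i |: S).
  rewrite cardsU1 iNS add1n ltnS; split=> // j.
  rewrite /red classM classV classJ in_setU1 => /orP[/eqP->|jS].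
    by apply: ncM; [apply: ncV|apply: ncJ].
  (* For [j] in [S] the commutator is read as [(u^-1)^y * u]. *)
  rewrite conjgE !mulgA; apply: ncM (uS j jS); rewrite -mulgA.
  rewrite -[_ * (_ * _)]/((class _ u)^-1 ^ class _ y).
  exact/ncJ/ncV/uS.
- apply/classP; rewrite !classJ; congr (_ ^ _).
  by apply/classP; apply: pres_cancel.
- exact: pres_refl.
- by apply: pres_sym.
- exact: pres_trans (IHv x) (IHw x).
- have /classP eu := IHu x; apply/classP; rewrite !classJ !classM !conjgM.
  rewrite !classJ in eu; rewrite eu -!classJ; exact/classP/IHv.
Qed.

Lemma at_meridians_cat (u v : word 'I_n) :
  at_meridians G (u ++ v) = at_meridians G u ++ at_meridians G v.
Proof. exact: map_cat. Qed.

Lemma at_meridians_winv (u : word 'I_n) :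
  at_meridians G (winv u) = winv (at_meridians G u).
Proof. by rewrite /at_meridians /winv map_rev -!map_comp. Qed.

Lemma lower_generation k : forall f : arc G -> word 'I_n,
    (forall c, pres_eq (lower_rel k) (at_meridians G (f c)) [:: (c, true)]) ->
  forall g : word (arc G),
    exists w, pres_eq (lower_rel k) (at_meridians G w) g.
Proof.
move=> f fP; elim=> [|[c b] g [w wg]]; first by exists [::]; apply: pres_refl.
exists ((if b then f c else winv (f c)) ++ w).
rewrite at_meridians_cat -cat1s; apply: pres_mul => //.
by case: b; rewrite // at_meridians_winv; apply: (pres_inv (fP c)).
Qed.

(** The word read above the arc is a word in the meridians at level [k]; conjugating a meridian by
    it gains one level, by [lower_conj]. *)
Lemma arc_lower k (c : arc G) :
  exists w, pres_eq (lower_rel k) (at_meridians G w) [:: (c, true)].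
Proof.
elim: k c => [|k IHk] c.
  exists [::]; apply/pres_sym/pres_rel; right; split=> //.
  by exists finset.set0; split=> // i; rewrite inE.
have [f fP] := choice IHk.
have [w wP] := lower_generation fP [seq tail_letter x | x <- heads_upto c].
exists (wconj [:: (string_of c, true)] w).
rewrite /wconj !at_meridians_cat at_meridians_winv.
apply: pres_trans (lower_conj wP _) _.
by apply/lower_red/pres_sym/arc_conj; left.
Qed.

(** At level [n.+1] the extra relations would require more than [n] strings. *)
Lemma meridians_generate (g : word (arc G)) :
  exists w, red_group_eq (at_meridians G w) g.
Proof.
have [f fP] := choice (arc_lower n.+1).
have [w wg] := lower_generation fP g; exists w.
apply: pres_mono wg => u v [uv|[_ [S [leS _]]]]; first exact: pres_rel.
by have := leq_trans leS (max_card _); rewrite card_ord ltnn.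
Qed.

End MeridiansGenerate.

(** * The Magnus expansion in triangular matrices *)

Section MagnusMatrix.
Import GRing.Theory.
Local Open Scope ring_scope.
Variables (n : nat) (I : seq 'I_n).
Hypothesis I_uniq : uniq I.
Let r := size I.

(* The entry [(a, b)] is the coefficient of the factor I_(a+1) ... I_b of [I]:
   cutting a factor in two is matrix multiplication. *)
Definition slice_mx (f : ncseries n) : 'M[int]_r.+1 :=
  \matrix_(a, b) (if (a <= b)%N then f (drop a (take b I)) else 0).

Lemma slice_mx1 : slice_mx (@nc_one n) = 1.
Proof.
apply/matrixP => a b; rewrite !mxE /nc_one /nilp size_drop size_takel; last first.
  by case: b => b /=; rewrite ltnS.
rewrite -val_eqE /= subn_eq0 eqn_leq.
by case: (a <= b)%N.
Qed.

Lemma slice_mxM f g : slice_mx (nc_mul f g) = slice_mx f * slice_mx g.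
Proof.
apply/matrixP => a b; rewrite [RHS]mxE mxE.
have b_le : (b <= r)%N by case: b => b /=; rewrite ltnS.
pose F c := (if (a <= c)%N then f (drop a (take c I)) else 0) *
            (if (c <= b)%N then g (drop c (take b I)) else 0).
transitivity (\sum_(c < r.+1) F c); last by apply: eq_bigr => c _; rewrite !mxE.
rewrite -(big_mkord xpredT F); case: leqP => [le_ab|lt_ba]; last first.
  rewrite big1_seq // => c _; rewrite /F.
  case: leqP => [le_ac|_]; last by rewrite mul0r.
  by rewrite leqNgt (leq_trans lt_ba le_ac) mulr0.
rewrite (@big_cat_nat _ _ _ b.+1) //= [X in _ = _ + X]big1_seq ?addr0; last first.
  move=> c /andP[_]; rewrite mem_index_iota => /andP[lt_bc _].
  by rewrite /F [(c <= b)%N]leqNgt lt_bc mulr0.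
rewrite (@big_cat_nat _ _ _ a) ?(leqW le_ab) //= [X in _ = X + _]big1_seq ?add0r.
  2: {
    move=> c /andP[_]; rewrite mem_index_iota => /andP[_ lt_ca].
    by rewrite /F leqNgt lt_ca mul0r. }
(* A cut after [k] letters of the slice is the position [c = k + a] of [I]. *)
rewrite -{1}[X in index_iota X]add0n big_addn big_mkord.
rewrite /nc_mul size_drop size_takel // -subSn //.
apply: eq_bigr => -[k /= lt_k] _; rewrite /F leq_addl.
have le_kab : (k + a <= b)%N by lia.
by rewrite le_kab take_drop drop_drop take_takel.
Qed.

(** For [i] outside [I] the index is [size I], whose successor is not a column, so the matrix is
    zero; otherwise it is a matrix unit just above the diagonal. *)
Definition shift_mx (i : 'I_n) : 'M[int]_r.+1 :=
  \matrix_(a, b) ((index i I == a) && (b == a.+1 :> nat))%:R.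

Lemma slice_eq1 (i : 'I_n) (a b : nat) : (a <= b <= r)%N ->
  (drop a (take b I) == [:: i]) = (index i I == a) && (b == a.+1).
Proof.
case/andP=> le_ab le_br; apply/eqP/andP => [Ei|[/eqP ia /eqP ba]].
  have b_a1 : b = a.+1.
    have := congr1 size Ei; rewrite size_drop size_takel //=; lia.
  split; last exact/eqP.
  have := cat_take_drop b I; rewrite -(cat_take_drop a (take b I)) Ei => EI.
  move: I_uniq; rewrite -EI !cat_uniq /= => /andP[/and3P[_ iN _] _].
  rewrite -catA index_cat ifN; last first.
    by move: iN; rewrite orbF.
  by rewrite /= eqxx addn0 size_take size_takel // b_a1 leqnn.
have lt_r : (index i I < r)%N by rewrite ia -ba.
rewrite ba -ia.
rewrite (take_nth i) // drop_rcons ?size_take ?lt_r //.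
rewrite drop_oversize ?size_take ?lt_r //= nth_index //.
by rewrite -index_mem.
Qed.

Definition sgn (b : bool) : int := if b then 1 else -1.

(** Slices of [I] have no repeated letter, so only the terms of degree at most one survive and the
    geometric series becomes [1 - X_i]. *)
Lemma slice_mx_letter x :
  slice_mx (magnus_letter x) = 1 + sgn x.2 *: shift_mx x.1.
Proof.
case: x => i b; apply/matrixP => a c; rewrite !mxE /magnus_letter /=.
have c_le : (c <= r)%N by case: c => c /=; rewrite ltnS.
case: leqP => [le_ac|lt_ca]; last first.
  rewrite -val_eqE /= gtn_eqF //.
  have /negPf -> : (c != a.+1 :> nat) by rewrite neq_ltn ltnW.
  by rewrite andbF mulr0 addr0.
have le_acr : (a <= c <= r)%N by rewrite le_ac.
have nil_slice : (drop a (take c I) == [::]) = (a == c).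
  by rewrite -size_eq0 size_drop size_takel // subn_eq0 -val_eqE /= eqn_leq le_ac.
have: uniq (drop a (take c I)) by rewrite drop_uniq ?take_uniq.
rewrite -slice_eq1 // -nil_slice.
case: (drop a (take c I)) => [|j [|k J]] /=; rewrite ?eqseq_cons ?eqxx ?andbT.
- by case: b; rewrite mulr0 addr0.
- by case: b; case: eqP => //= _ _; rewrite add0r // mulr1.
- rewrite inE !andbF !add0r mulr0; case: b => //=.
  by case: (j =P i) => // ->; case: (k =P i) => //= ->; rewrite eqxx.
Qed.

Lemma slice_mx_magnus (w : word 'I_n) :
  slice_mx (magnus w) = \prod_(x <- w) (1 + sgn x.2 *: shift_mx x.1).
Proof.
elim: w => [|x w IHw]; first by rewrite big_nil slice_mx1.
by rewrite big_cons -IHw -slice_mx_letter -slice_mxM.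
Qed.

End MagnusMatrix.

(** * Triangular matrices filtered by superdiagonals *)

Section Above.
Import GRing.Theory.
Local Open Scope ring_scope.
Variable p : nat.
Implicit Types A B : 'M[int]_p.+1.

(** Level 0 means upper triangular, level 1 strictly so, and level [p.+1] zero. *)
Definition above k A : Prop := 
  forall a b : 'I_p.+1, (b < a + k)%N -> A a b = 0.

Lemma above0 k : above k 0. Proof. by move=> a b _; rewrite mxE. Qed.

Lemma above1 : above 0 1.
Proof. by move=> a b; rewrite addn0 mxE -val_eqE => /gtn_eqF ->. Qed.

Lemma aboveD k A B : above k A -> above k B -> above k (A + B).
Proof. by move=> kA kB a b lt; rewrite mxE kA // kB // addr0. Qed.

Lemma aboveZ k c A : above k A -> above k (c *: A).
Proof. by move=> kA a b lt; rewrite mxE kA // mulr0. Qed.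

Lemma aboveN k A : above k A -> above k (- A).
Proof. by rewrite -scaleN1r; apply: aboveZ. Qed.

Lemma aboveM k l A B : above k A -> above l B -> above (k + l) (A * B).
Proof.
move=> kA lB a b lt; rewrite mxE big1 // => c _.
have [/kA ->|le_c] := ltnP c (a + k); first by rewrite mul0r.
by rewrite lB ?mulr0 //; lia.
Qed.

Lemma aboveMr0 k A B : above k A -> above 0 B -> above k (A * B).
Proof. by move=> kA B0; rewrite -[k]addn0; apply: aboveM. Qed.

Lemma mulB_telescope A A' B B' :
  A * B - A' * B' = (A - A') * B + A' * (B - B').
Proof. by rewrite mulrBl mulrBr addrA subrK. Qed.

Lemma aboveW k l A : (k <= l)%N -> above l A -> above k A.
Proof. by move=> le_kl lA a b lt; apply: lA; lia. Qed.

Lemma above_eq0 A : above p.+1 A -> A = 0.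
Proof.
move=> A0; apply/matrixP => a b; rewrite mxE A0 //.
by apply: leq_trans (ltn_ord b) (leq_addl _ _).
Qed.

Lemma above_prod (T : Type) (s : seq T) (F : T -> 'M[int]_p.+1) :
  (forall x, above 0 (F x)) -> above 0 (\prod_(x <- s) F x).
Proof.
by move=> F0; apply: big_ind => [|A B|x _]; [exact: above1|exact: aboveM|].
Qed.

End Above.

(** * Products of unipotent letters along a string *)

Section HeadProducts.
Import GRing.Theory.
Local Open Scope ring_scope.
Variables (n p : nat) (G : gauss_diagram n).
Implicit Types (y z : arrow G -> 'M[int]_p.+1) (s : seq (arrow G)).

(** Image of the letters read at the heads [s] when the arc at the tail of [x] goes to [1 + y x]; if
    [y x] has square zero, the inverse letter goes to [1 - y x]. *)
Definition head_prod y s := \prod_(x <- s) (1 + sign x *: y x).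

(* The inverse of [head_prod y s] as soon as every [y x] has square zero. *)
Definition head_prodV y s := head_prod (fun x => - y x) (rev s).

Lemma above_letter y x : above 1 (y x) -> above 0 (1 + sign x *: y x).
Proof.
move=> y1; apply: aboveD (@above1 p) _.
by apply: (aboveW (leq0n 1)); apply: aboveZ.
Qed.

Lemma above_head_prod y s : (forall x, above 1 (y x)) -> above 0 (head_prod y s).
Proof. by move=> y1; apply: above_prod => x; apply: above_letter. Qed.

Lemma above_head_prodV y s :
  (forall x, above 1 (y x)) -> above 0 (head_prodV y s).
Proof. by move=> y1; apply: above_head_prod => x; apply: aboveN. Qed.

(** The difference telescopes into terms that change one factor at a time, all other factors having
    level 0. *)
Lemma above_head_prodB k y z s :
    (forall x, above 1 (y x)) -> (forall x, above 1 (z x)) ->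
    (forall x, above k (y x - z x)) ->
  above k (head_prod y s - head_prod z s).
Proof.
move=> y1 z1 yz; rewrite /head_prod; elim: s => [|x s IHs].
  by rewrite !big_nil subrr; apply: above0.
rewrite !big_cons; set P := \prod_(_ <- _) _ in IHs *.
set P' := \prod_(_ <- _) _ in IHs *.
rewrite mulB_telescope opprD addrACA subrr add0r -scalerBr; apply: aboveD.
  rewrite -[k]addn0; apply: aboveM; first exact: aboveZ.
  exact: above_head_prod.
by rewrite -[k]add0n; apply: aboveM => //; apply: above_letter.
Qed.

Lemma head_prodK y s :
    (forall x, y x * y x = 0) -> head_prod y s * head_prodV y s = 1.
Proof.
move=> yy; elim: s => [|x s IHs];
  first by rewrite /head_prodV /head_prod !big_nil mulr1.
rewrite /head_prodV rev_cons /head_prod big_cons -cats1 big_cat /= big_seq1.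
rewrite -!mulrA [X in _ * X]mulrA [X in _ * (X * _)]IHs mul1r.
rewrite scalerN mulrDl mul1r mulrBr mulr1 -scalerAl -scalerAr yy !scaler0.
by rewrite subr0 subrK.
Qed.

Lemma head_prodVK y s :
    (forall x, y x * y x = 0) -> head_prodV y s * head_prod y s = 1.
Proof.
move=> yy; have := @head_prodK (fun x => - y x) (rev s).
rewrite /head_prodV revK => <- => [|x]; last by rewrite mulrNN.
by congr (_ * _); apply: eq_bigr => x _; rewrite opprK.
Qed.

End HeadProducts.

(** * The unipotent representation of the reduced tangle group *)

Section Representation.
Import GRing.Theory.
Local Open Scope ring_scope.
Variables (n : nat) (I : seq 'I_n) (G : gauss_diagram n).
Let r := size I.
Let X := shift_mx I.
Implicit Types (y z : arrow G -> 'M[int]_r.+1).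

Lemma above_shift i : above 1 (X i).
Proof.
by move=> a b lt; rewrite mxE; case: eqP => // _; case: eqP => //; lia.
Qed.

(** Only the entry of [A] at [(a + 1, a)], with [a = index i I], could contribute, and it lies below
    the diagonal. This makes a meridian commute with its conjugates. *)
Lemma shift_upper i A : above 0 A -> X i * A * X i = 0.
Proof.
move=> A0; apply/matrixP => a b; rewrite mxE [RHS]mxE big1 // => c _; rewrite mxE.
case: (index i I =P c) => [ic|nic]; last by rewrite !mxE (introF eqP nic) mulr0.
rewrite big1 ?mul0r // => d _; rewrite !mxE; case: eqP => [ia|]; last by rewrite mul0r.
case: eqP => [da|]; last by rewrite mul0r.
by rewrite A0 ?mulr0 //; lia.
Qed.

Definition conj_shift y (c : arc G) : 'M[int]_r.+1 :=
  head_prodV y (heads_upto c) * X (string_of c) * head_prod y (heads_upto c).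

Lemma above_conj_shift y c : (forall x, above 1 (y x)) -> above 1 (conj_shift y c).
Proof.
move=> y1; rewrite -[1%N]addn0; apply: aboveM; last exact: above_head_prod.
rewrite -[1%N]add0n; apply: aboveM; first exact: above_head_prodV.
exact: above_shift.
Qed.

(** The factor [X i] raises the level by one, so [conj_shift] is contracting for the filtration. *)
Lemma above_conj_shiftB k y z c :
    (forall x, above 1 (y x)) -> (forall x, above 1 (z x)) ->
    (forall x, above k (y x - z x)) ->
  above k.+1 (conj_shift y c - conj_shift z c).
Proof.
move=> y1 z1 yz; rewrite /conj_shift /head_prodV.
set s := heads_upto c; set i := string_of c; set Q := head_prod _ (rev s).
set Q' := head_prod _ (rev s); set P := head_prod _ s; set P' := head_prod _ s.
have -> : Q * X i * P - Q' * X i * P' =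
    (Q - Q') * X i * P + Q' * X i * (P - P').
  by rewrite [LHS]mulB_telescope -mulrBl.
apply: aboveD.
  rewrite -[k.+1]addn0 -addn1; apply: aboveM; last exact: above_head_prod.
  apply: aboveM (above_shift i); apply: above_head_prodB => x; try exact: aboveN.
  by rewrite -opprD; apply: aboveN.
rewrite -add1n; apply: aboveM; last exact: above_head_prodB.
by rewrite -[1%N]add0n; apply: aboveM (above_shift i); apply: above_head_prodV.
Qed.

(** Iterating from 0, the difference of successive iterates gains one level at each step; after [r]
    steps it has level [r.+1] and vanishes. *)
Lemma conj_shift_fixpoint : exists y,
  (forall x, above 1 (y x)) /\
  (forall x, y x = conj_shift y (arc_at (tail_of x))).
Proof.
pose Y k := iter k (fun y x => conj_shift y (arc_at (tail_of x))) (fun=> 0).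
have Y1 k x : above 1 (Y k x).
  by elim: k x => [|k IHk] x /=; [apply: above0|apply: above_conj_shift].
have YB k x : above k.+1 (Y k.+1 x - Y k x).
  elim: k x => [|k IHk] x; first by rewrite subr0; apply: Y1.
  by apply: (@above_conj_shiftB k.+1 (Y k.+1) (Y k)); [apply: Y1|apply: Y1|].
exists (Y r); split=> // x; apply/esym/eqP; rewrite -subr_eq0; apply/eqP.
exact: above_eq0 (YB r x).
Qed.

Section FixedPoint.
Variable y : arrow G -> 'M[int]_r.+1.
Hypothesis y_above : forall x, above 1 (y x).
Hypothesis y_fix : forall x, y x = conj_shift y (arc_at (tail_of x)).

(** The square [Q X (P Q) X P] vanishes because [P Q] is upper triangular. The identity [P Q = 1]
    cannot serve here: it rests on [y_sqr], which is deduced from this lemma. *)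
Lemma conj_shift_sqr c : conj_shift y c * conj_shift y c = 0.
Proof.
rewrite /conj_shift; set Q := head_prodV _ _; set P := head_prod _ _.
have PQ : above 0 (P * Q).
  by apply: (@aboveM _ 0 0); [apply: above_head_prod|apply: above_head_prodV].
by rewrite !mulrA -(mulrA _ P) -(mulrA Q) -(mulrA Q) shift_upper // mulr0 mul0r.
Qed.

Lemma y_sqr x : y x * y x = 0.
Proof. by rewrite y_fix conj_shift_sqr. Qed.

Lemma conj_shift_meridian i : conj_shift y (meridian G i) = X i.
Proof.
by rewrite /conj_shift /head_prodV /head_prod !big_nil mulr1 mul1r.
Qed.

Definition letter_mx (x : arc G * bool) : 'M[int]_r.+1 :=
  1 + sgn x.2 *: conj_shift y x.1.

Definition word_mx (w : word (arc G)) : 'M[int]_r.+1 :=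
  \prod_(x <- w) letter_mx x.

Lemma word_mx_cat u v : word_mx (u ++ v) = word_mx u * word_mx v.
Proof. exact: big_cat. Qed.

Lemma word_mx1 x : word_mx [:: x] = letter_mx x.
Proof. exact: big_seq1. Qed.

Lemma letter_mxK c b : letter_mx (c, b) * letter_mx (c, ~~ b) = 1.
Proof.
rewrite /letter_mx /=.
have -> : sgn (~~ b) = - sgn b by case: b; rewrite /= ?opprK.
rewrite scaleNr mulrDl mul1r mulrBr mulr1 -scalerAl -scalerAr conj_shift_sqr.
by rewrite !scaler0 subr0 subrK.
Qed.

Lemma word_mxV u : word_mx u * word_mx (winv u) = 1.
Proof.
elim: u => [|[c b] u IHu]; first by rewrite /word_mx !big_nil mulr1.
rewrite -cat1s winv_cat !word_mx_cat mulrA -(mulrA _ (word_mx u)) IHu mulr1.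
by rewrite !word_mx1 letter_mxK.
Qed.

Lemma word_mxVK u : word_mx (winv u) * word_mx u = 1.
Proof. by rewrite -{2}[u]winvK word_mxV. Qed.

Lemma above_word_mx u : above 0 (word_mx u).
Proof.
apply: above_prod => x; apply: aboveD (@above1 r) _; apply: aboveZ.
by apply: (aboveW (leq0n 1)); apply: above_conj_shift.
Qed.

Lemma tail_letter_mx (s : seq (arrow G)) :
  word_mx [seq tail_letter x | x <- s] = head_prod y s.
Proof.
by rewrite /word_mx big_map; apply: eq_bigr => x _; rewrite /letter_mx /= -y_fix.
Qed.

(** The heads above the outgoing arc are those above the incoming one followed by [a], so its
    nilpotent part is conjugated by the letter at the tail of [a]. *)
Lemma wirtinger_mx u v : wirtinger u v -> word_mx u = word_mx v.
Proof.
case=> a [-> ->]; rewrite /wconj !word_mx_cat !word_mx1 /letter_mx /=.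
set c := arc_at (head_of a); have -> : sgn (~~ positive a) = - sign a.
  by rewrite /sign; case: positive; rewrite /= ?opprK.
rewrite -y_fix scale1r -[sgn _]/(sign a) scale1r scaleNr -scalerN.
have heads_a : heads_upto (inr a : arc G) = rcons (heads_upto c) a.
  by rewrite heads_upto_arc_at.
have -> : conj_shift y (inr a : arc G) =
    (1 + sign a *: - y a) * conj_shift y c * (1 + sign a *: y a).
  rewrite /conj_shift heads_a string_of_arc_at /head_prodV rev_rcons.
  by rewrite /head_prod big_cons -cats1 big_cat big_seq1 /= !mulrA.
have LR : (1 + sign a *: - y a) * (1 + sign a *: y a) = 1.
  rewrite scalerN mulrDr mulr1 mulrBl mul1r -scalerAl -scalerAr y_sqr.
  by rewrite !scaler0 subr0 subrK.
move: (1 + sign a *: - y a) (1 + sign a *: y a) LR => L P LR.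
by rewrite mulrDl mul1r mulrDr LR mulrA.
Qed.

(** The nilpotent parts of a meridian and of its conjugate annihilate each other by [shift_upper],
    so the two images commute. *)
Lemma reduced_rel_mx u v : reduced_rel u v -> word_mx u = word_mx v.
Proof.
case=> [|[i [w [-> ->]]]]; first exact: wirtinger_mx.
set m := [:: _].
have mC : word_mx m * word_mx (wconj m w) = word_mx (wconj m w) * word_mx m.
  have XwX : X i * (word_mx (winv w) * X i * word_mx w) = 0.
    by rewrite !mulrA shift_upper ?mul0r //; apply: above_word_mx.
  have wXX : word_mx (winv w) * X i * word_mx w * X i = 0.
    rewrite -!mulrA [X in _ * X](_ : _ = 0) ?mulr0 // mulrA shift_upper //.
    exact: above_word_mx.
  have -> : word_mx m = 1 + X i.
    by rewrite word_mx1 /letter_mx /= conj_shift_meridian scale1r.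
  have -> : word_mx (wconj m w) = 1 + word_mx (winv w) * X i * word_mx w.
    rewrite /wconj !word_mx_cat word_mx1 /letter_mx /= conj_shift_meridian.
    by rewrite scale1r mulrDl mul1r mulrDr word_mxVK mulrA.
  by rewrite !mulrDl !mulrDr !mul1r !mulr1 XwX wXX !addr0 addrAC.
move: (wconj m w) mC => c mC; rewrite /wcomm !word_mx_cat mC.
rewrite !mulrA -(mulrA _ (word_mx (winv _))) word_mxVK mulr1.
by rewrite word_mxVK /word_mx big_nil.
Qed.

Lemma red_group_eq_mx u v : red_group_eq u v -> word_mx u = word_mx v.
Proof.
elim=> {u v} [u v|x b|u|u v _ ->|u v w _ -> _ ->|u u' v v' _ IHu _ IHv] //.
- exact: reduced_rel_mx.
- by rewrite -cat1s word_mx_cat !word_mx1 letter_mxK /word_mx big_nil.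
- by rewrite !word_mx_cat IHu IHv.
Qed.

(** Every preimage has the same matrix as the parallel, and the corner entry of that matrix is the
    coefficient of the whole of [I]. *)
Lemma milnor_head_prod (j : 'I_n) : uniq I -> j \notin I ->
  milnor G I j =
  head_prod y [seq e.1 | e <- strand G j & e.2] ord0 ord_max.
Proof.
move=> I_uniq jI; rewrite /milnor /theta /mod_repeats I_uniq.
set w := red_preimage _.
(* Generation by the meridians ensures that [xget] returns a genuine preimage instead of falling
   back on its default [[::]]. *)
have wP : red_group_eq (at_meridians G w) (parallel G j).
  exact: (xgetPex [::] (meridians_generate (parallel G j))).
have : slice_mx I (magnus w) = word_mx (parallel G j).
  rewrite slice_mx_magnus // -(red_group_eq_mx wP) /word_mx /at_meridians big_map.
  by apply: eq_bigr => x _; rewrite /letter_mx /= conj_shift_meridian.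
move=> /matrixP/(_ ord0 ord_max); rewrite mxE /= drop0 take_size => ->.
rewrite /parallel word_mx_cat [word_mx (wpow _ _)](_ : _ = 1).
  by rewrite mulr1 /parallel_word -tail_letter_mx -map_comp.
(* As [j] is not in [I], the framing correction by a power of [m_j] acts as the identity. *)
have X0 : X j = 0.
  apply/matrixP => a b; rewrite !mxE; case: eqP => // ja.
  case: eqP => // ba; case/negP: jI.
  by rewrite -index_mem ja -ltnS -ba.
rewrite /word_mx /wpow big1_seq // => x /andP[_ /nseqP[-> _]].
by rewrite /letter_mx conj_shift_meridian X0 scaler0 addr0.
Qed.

End FixedPoint.
End Representation.

(** * Expansion of the matrix entries *)

Section OrderedSums.
Import GRing.Theory.
Local Open Scope ring_scope.
Variable T : finType.
Implicit Types (f g : T -> int) (fs : seq (T -> int)) (s t : seq T).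

(* The sum of [fs_1 x_1 * ... * fs_k x_k] over the subsequences [x_1, ..., x_k]
   of [s]. *)
Fixpoint osum fs s {struct s} : int :=
  match fs, s with
  | [::], _ => 1
  | _ :: _, [::] => 0
  | f :: fs', x :: s' => f x * osum fs' s' + osum fs s'
  end.

Lemma osum0 s : osum [::] s = 1. Proof. by case: s. Qed.

Lemma eq_osum1 f g fs s : f =1 g -> osum (f :: fs) s = osum (g :: fs) s.
Proof. by move=> fg; elim: s => //= x s ->; rewrite fg. Qed.

Lemma eq_osum2 h f g fs s : f =1 g ->
  osum (h :: f :: fs) s = osum (h :: g :: fs) s.
Proof. by move=> fg; elim: s => //= x s ->; rewrite (eq_osum1 _ _ fg). Qed.

Lemma eq_osum3 h h' f g fs s : f =1 g ->
  osum (h :: h' :: f :: fs) s = osum (h :: h' :: g :: fs) s.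
Proof. by move=> fg; elim: s => //= x s ->; rewrite (eq_osum2 _ _ _ fg). Qed.

Lemma osumD1 f g fs s :
  osum ((f \+ g) :: fs) s = osum (f :: fs) s + osum (g :: fs) s.
Proof. by elim: s => [|x s /= ->]; rewrite /= ?addr0 //; ring. Qed.

Lemma osumN1 f fs s : osum ((fun x => - f x) :: fs) s = - osum (f :: fs) s.
Proof. by elim: s => [|x s /= ->]; rewrite /= ?oppr0 //; ring. Qed.

Lemma osumD2 h f g fs s :
  osum (h :: (f \+ g) :: fs) s = osum (h :: f :: fs) s + osum (h :: g :: fs) s.
Proof. by elim: s => [|x s /= ->]; rewrite /= ?addr0 ?osumD1 //; ring. Qed.

Lemma osumN2 h f fs s :
  osum (h :: (fun x => - f x) :: fs) s = - osum (h :: f :: fs) s.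
Proof. by elim: s => [|x s /= ->]; rewrite /= ?oppr0 ?osumN1 //; ring. Qed.

(** The shuffle product; the hypothesis removes the terms where both factors pick the same
    position. *)
Lemma osumM f g s : (forall x, f x * g x = 0) ->
  osum [:: f] s * osum [:: g] s = osum [:: f; g] s + osum [:: g; f] s.
Proof.
move=> fg; elim: s => [|x s IHs] /=; first by rewrite mulr0.
rewrite !osum0 !mulr1 addrACA -IHs; set p := osum _ s; set q := osum _ s.
have -> : (f x + p) * (g x + q) = f x * g x + (f x * q + g x * p + p * q) by ring.
by rewrite fg add0r.
Qed.

(** Unlike [osum], this runs over all tuples and leaves the order condition to the weight [F]; sums
    over finite functions take this form. *)
Fixpoint tsum fs (F : seq T -> int) : int :=
  if fs is f :: fs' then \sum_x f x * tsum fs' (fun t => F (x :: t)) else F [::].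

Lemma eq_tsum fs F F' : F =1 F' -> tsum fs F = tsum fs F'.
Proof.
elim: fs F F' => [|f fs IHfs] F F' eF /=; first exact: eF.
by apply: eq_bigr => x _; congr (_ * _); apply: IHfs => t; apply: eF.
Qed.

Lemma tsum0 fs : tsum fs (fun=> 0) = 0.
Proof.
by elim: fs => //= f fs IHfs; rewrite big1 // => x _; rewrite IHfs mulr0.
Qed.

(** Without repetition a tuple occurs in [s] at most once. The induction separates the tuples that
    begin with the first element of [s]. *)
Lemma tsum_subseq fs s :
  uniq s -> tsum fs (fun t => (subseq t s)%:R) = osum fs s.
Proof.
elim: fs s => [|f fs IHfs] s; first by rewrite /= osum0 sub0seq.
elim: s => [_|z s IHs /= /andP[zs s_uniq]].
  by rewrite /= big1 // => x _; rewrite tsum0 mulr0.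
rewrite -IHs // -IHfs // [LHS](bigD1 z) //= [X in _ = _ + X](bigD1 z) //=.
have -> : tsum fs (fun t => (subseq (z :: t) s)%:R) = 0.
  rewrite -(tsum0 fs); apply: eq_tsum => t.
  case: (boolP (subseq (z :: t) s)) => // /mem_subseq/(_ z (mem_head _ _)).
  by rewrite (negPf zs).
rewrite eqxx mulr0 add0r; congr (_ + _); apply: eq_bigr => x /negPf xz.
by rewrite xz.
Qed.

End OrderedSums.

(** * Entries near the diagonal of head products and of their inverses *)

Section Entries.
Import GRing.Theory.
Local Open Scope ring_scope.

(* Meaningful for [a, b <= p] only: [inord] sends larger indices to 0. *)
Definition entry p (A : 'M[int]_p.+1) (a b : nat) : int :=
  A (inord a) (inord b).

Lemma entry_above k p (A : 'M[int]_p.+1) a b :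
  above k A -> (a <= p)%N -> (b < a + k)%N -> (b <= p)%N -> entry A a b = 0.
Proof. by move=> kA ap lt bp; rewrite /entry kA // !inordK. Qed.

Lemma entry1 p a b : (a <= p)%N -> (b <= p)%N ->
  entry (1 : 'M[int]_p.+1) a b = (a == b)%:R.
Proof. by move=> ap bp; rewrite /entry mxE -val_eqE /= !inordK. Qed.

Lemma entryD p (A B : 'M[int]_p.+1) a b :
  entry (A + B) a b = entry A a b + entry B a b.
Proof. by rewrite /entry mxE. Qed.

Lemma entryZ p c (A : 'M[int]_p.+1) a b : entry (c *: A) a b = c * entry A a b.
Proof. by rewrite /entry mxE. Qed.

Lemma entryM k p (A B : 'M[int]_p.+1) a b :
    above k A -> above 0 B -> (a + k <= b.+1)%N -> (a <= b <= p)%N ->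
  entry (A * B) a b = \sum_(a + k <= c < b.+1) entry A a c * entry B c b.
Proof.
move=> kA lB le_akb /andP[le_ab le_bp]; rewrite /entry mxE.
rewrite (eq_bigr (fun c : 'I_p.+1 => entry A a c * entry B c b)); last first.
  by move=> c _; rewrite /entry inord_val.
rewrite -(big_mkord xpredT (fun c => entry A a c * entry B c b)).
rewrite (@big_cat_nat _ _ _ (a + k)) //=; last by lia.
rewrite (@big_cat_nat _ _ _ b.+1 (a + k)) //=.
rewrite big1_seq ?add0r => [|c].
  rewrite [X in _ + X]big1_seq ?addr0 // => c.
  rewrite mem_index_iota => /andP[_ /andP[lt_c cp]].
  by rewrite [X in _ * X](@entry_above 0) ?mulr0 //; lia.
rewrite mem_index_iota => /andP[_ /andP[_ lt_c]].
by rewrite (@entry_above k) ?mul0r //; lia.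
Qed.

Lemma entry_shift n (I : seq 'I_n) i a b : (a <= size I)%N -> (b <= size I)%N ->
  entry (shift_mx I i) a b = ((index i I == a) && (b == a.+1))%:R.
Proof. by move=> ap bp; rewrite /entry mxE !inordK. Qed.

Section HeadEntries.
Variables (n p : nat) (G : gauss_diagram n) (y : arrow G -> 'M[int]_p.+1).
Hypothesis y_above : forall x, above 1 (y x).
Implicit Type s : seq (arrow G).

Definition signed_entry a b x := sign x * entry (y x) a b.
Local Notation Y := signed_entry.
Let P0 s : above 0 (head_prod y s) := above_head_prod s y_above.
Let Q0 s : above 0 (head_prodV y s) := above_head_prodV s y_above.

Lemma entry_head_prod_diag s a : (a <= p)%N -> entry (head_prod y s) a a = 1.
Proof.
move=> ap; elim: s => [|x s IHs].
  by rewrite /head_prod big_nil entry1 // eqxx.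
rewrite /head_prod big_cons -/(head_prod y s) mulrDl mul1r entryD IHs.
have yP : above 1 (sign x *: y x * head_prod y s).
  by apply: aboveMr0 => //; apply: aboveZ.
by rewrite (entry_above yP) ?addr0 // addn1.
Qed.

Lemma entry_head_prod_cons x s a b : (a < b <= p)%N ->
  entry (head_prod y (x :: s)) a b =
  \sum_(a.+1 <= c < b.+1) Y a c x * entry (head_prod y s) c b +
  entry (head_prod y s) a b.
Proof.
move=> /andP[ab bp]; rewrite /head_prod big_cons -/(head_prod y s).
rewrite mulrDl mul1r entryD addrC.
rewrite (@entryM 1); [|exact: aboveZ|exact: P0|lia|lia].
rewrite addn1; congr (_ + _); apply: eq_bigr => c _.
by rewrite entryZ.
Qed.

Lemma entry_head_prod1 s a : (a.+1 <= p)%N ->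
  entry (head_prod y s) a a.+1 = osum [:: Y a a.+1] s.
Proof.
move=> ap; elim: s => [|x s IHs].
  rewrite /head_prod big_nil entry1; [|lia|lia].
  by rewrite (_ : (a == _) = false) //; lia.
rewrite entry_head_prod_cons ?ltnSn // big_nat1 entry_head_prod_diag //.
by rewrite IHs /= osum0.
Qed.

(** One term for each way of climbing from [a] to [a.+2] in positive steps, taken at successive
    heads. *)
Lemma entry_head_prod2 s a : (a.+2 <= p)%N ->
  entry (head_prod y s) a a.+2 =
  osum [:: Y a a.+2] s + osum [:: Y a a.+1; Y a.+1 a.+2] s.
Proof.
move=> ap; elim: s => [|x s IHs].
  rewrite /head_prod big_nil entry1; [|lia|lia].
  by rewrite (_ : (a == _) = false) //; lia.
rewrite entry_head_prod_cons; last by lia.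
rewrite big_ltn; [|lia]; rewrite big_nat1 entry_head_prod_diag // entry_head_prod1 //.
by rewrite IHs /= osum0; ring.
Qed.

Lemma entry_head_prod3 s a : (a.+3 <= p)%N ->
  entry (head_prod y s) a a.+3 =
  osum [:: Y a a.+3] s + osum [:: Y a a.+1; Y a.+1 a.+3] s +
  osum [:: Y a a.+2; Y a.+2 a.+3] s +
  osum [:: Y a a.+1; Y a.+1 a.+2; Y a.+2 a.+3] s.
Proof.
move=> ap; elim: s => [|x s IHs].
  rewrite /head_prod big_nil entry1; [|lia|lia].
  by rewrite (_ : (a == _) = false) //; lia.
rewrite entry_head_prod_cons; last by lia.
rewrite big_ltn; [|lia]; rewrite big_ltn; [|lia].
rewrite big_nat1 entry_head_prod_diag //.
rewrite entry_head_prod1 // entry_head_prod2 // IHs /= osum0; ring.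
Qed.

Hypothesis y_sqr : forall x, y x * y x = 0.

(** Entrywise form of the inverse relation, solved below for the inverse one superdiagonal at a
    time. *)
Lemma entry_head_prodV s a b : (a <= b <= p)%N ->
  \sum_(a <= c < b.+1) entry (head_prodV y s) a c * entry (head_prod y s) c b =
  (a == b)%:R.
Proof.
move=> /andP[ab bp]; have := @entryM 0 _ _ _ a b (Q0 s) (P0 s).
rewrite addn0 => <-; [|lia|lia].
by rewrite head_prodVK // entry1 //; lia.
Qed.

Lemma entry_head_prodV_diag s a : (a <= p)%N -> entry (head_prodV y s) a a = 1.
Proof.
move=> ap; have := @entry_head_prodV s a a.
by rewrite leqnn big_nat1 entry_head_prod_diag // mulr1 eqxx => ->.
Qed.

Lemma entry_head_prodV1 s a : (a.+1 <= p)%N ->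
  entry (head_prodV y s) a a.+1 = - osum [:: Y a a.+1] s.
Proof.
move=> ap; have := @entry_head_prodV s a a.+1.
rewrite leqnSn ap => /(_ isT); rewrite big_ltn // big_nat1.
rewrite entry_head_prod_diag // entry_head_prodV_diag 1?ltnW //.
rewrite entry_head_prod1 // ltn_eqF // mul1r mulr1 => /eqP.
by rewrite addrC addr_eq0 => /eqP.
Qed.

Lemma entry_head_prodV2 s a : (a.+2 <= p)%N ->
  entry (head_prodV y s) a a.+2 =
  - osum [:: Y a a.+2] s - osum [:: Y a a.+1; Y a.+1 a.+2] s
  + osum [:: Y a a.+1] s * osum [:: Y a.+1 a.+2] s.
Proof.
move=> ap; have := @entry_head_prodV s a a.+2.
rewrite ap andbT => /(_ ltac:(lia)).
rewrite big_ltn; [|lia]; rewrite big_ltn; [|lia]; rewrite big_nat1.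
rewrite entry_head_prod_diag // entry_head_prodV_diag; last by lia.
rewrite entry_head_prod1 // entry_head_prod2 // entry_head_prodV1; last by lia.
rewrite mul1r mulr1 (_ : (a == a.+2) = false); last by lia.
move=> /eqP; rewrite addrA addrC addr_eq0 => /eqP ->; ring.
Qed.

End HeadEntries.
End Entries.

(** * Expansion of the fixed point over arrows *)

Section MilnorSums.
Import GRing.Theory.
Local Open Scope ring_scope.
Variables (n : nat) (G : gauss_diagram n).
Implicit Types (i j k l : 'I_n) (x : arrow G).

Definition heads j : seq (arrow G) := [seq e.1 | e <- strand G j & e.2].

Definition tails_on i x : int := sign x * (on (tail_of x) == i)%:R.
Local Notation F := tails_on.
Local Notation H x := (heads_before (tail_of x)).

Section FixedPoint.
Variables (I : seq 'I_n).
Let r := size I.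
Variable y : arrow G -> 'M[int]_r.+1.
Hypothesis y_above : forall x, above 1 (y x).
Hypothesis y_fix : forall x, y x = conj_shift y (arc_at (tail_of x)).
Hypothesis I_uniq : uniq I.
Local Notation Y := (signed_entry y).
Let y2 x : y x * y x = 0 := y_sqr y_above y_fix x.

(** Only the entries [(c, c.+1)] of the shift can be nonzero, so the sum runs over the place [c] in
    [I] taken by the string of the tail of [x]. *)
Lemma entry_fix x a b : (a < b <= r)%N ->
  entry (y x) a b =
  \sum_(a <= c < b) entry (head_prodV y (H x)) a c *
    ((index (on (tail_of x)) I == c)%:R * entry (head_prod y (H x)) c.+1 b).
Proof.
move=> /andP[ab br]; rewrite y_fix /conj_shift heads_upto_arc_at string_of_arc_at.
set Q := head_prodV _ _; set P := head_prod _ _; set i := on _.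
have Q0 : above 0 Q by apply: above_head_prodV.
have P0 : above 0 P by apply: above_head_prod.
have XP1 : above 1 (shift_mx I i * P) by apply: aboveMr0 => //; apply: above_shift.
rewrite -mulrA (@entryM 0) ?addn0; try lia; try by []; last first.
  by apply: aboveW XP1.
(* The last term, [c = b], vanishes because the shift times [P] is strictly triangular. *)
rewrite big_nat_recr ?(ltnW ab) //=.
rewrite [entry (shift_mx I i * P) b b](@entry_above 1) //; last by lia.
rewrite mulr0 addr0; apply: eq_big_nat => c /andP[ac cb]; congr (_ * _).
rewrite (@entryM 1) //; try lia; last exact: above_shift.
rewrite addn1 big_ltn // big1_seq ?addr0 => [|d].
  by rewrite entry_shift -/r ?eqxx ?andbT //; lia.
rewrite mem_index_iota => /andP[_ /andP[cd db]].
by rewrite entry_shift -/r; [rewrite (gtn_eqF cd) andbF mul0r|lia|lia].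
Qed.

Lemma index_on i0 x a : (a < r)%N ->
  (index (on (tail_of x)) I == a) = (on (tail_of x) == nth i0 I a).
Proof.
move=> ar; apply/eqP/eqP => [ia|->]; last by rewrite index_uniq.
by rewrite -ia nth_index // -index_mem ia.
Qed.

Variable i0 : 'I_n.
Local Notation It := (nth i0 I).

Lemma entry_fix1 x a : (a.+1 <= r)%N -> Y a a.+1 x = F (It a) x.
Proof.
move=> ar; rewrite /signed_entry entry_fix ?ltnSn // big_nat1.
rewrite entry_head_prodV_diag // 1?ltnW // entry_head_prod_diag //.
by rewrite mul1r mulr1 (index_on i0).
Qed.

(** The root [x] takes one of the two letters. The other one comes from the product if it follows in
    [I], and from the inverse, with a minus sign, if it precedes. *)
Lemma entry_fix2 x a : (a.+2 <= r)%N -> Y a a.+2 x =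
  F (It a) x * osum [:: F (It a.+1)] (H x) -
  F (It a.+1) x * osum [:: F (It a)] (H x).
Proof.
move=> ar; rewrite /signed_entry entry_fix; last by lia.
rewrite big_ltn // big_nat1.
rewrite entry_head_prodV_diag //; last by lia.
rewrite entry_head_prod1 // entry_head_prodV1 //; last by lia.
rewrite entry_head_prod_diag // /tails_on !(index_on i0) //; last by lia.
rewrite (eq_osum1 _ _ (fun z => entry_fix1 z ar)).
rewrite (eq_osum1 _ _ (fun z => @entry_fix1 z a (ltnW ar))).
ring.
Qed.

(** The three summands place the root at the first, second and last letter. *)
Lemma entry_fix3 x a : (a.+3 <= r)%N -> Y a a.+3 x =
  F (It a) x * (osum [:: Y a.+1 a.+3] (H x) +
                osum [:: F (It a.+1); F (It a.+2)] (H x)) -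
  F (It a.+1) x * (osum [:: F (It a)] (H x) * osum [:: F (It a.+2)] (H x)) +
  F (It a.+2) x * (osum [:: F (It a)] (H x) * osum [:: F (It a.+1)] (H x) -
                   osum [:: Y a a.+2] (H x) -
                   osum [:: F (It a); F (It a.+1)] (H x)).
Proof.
move=> ar; rewrite /signed_entry entry_fix; last by lia.
rewrite big_ltn; [|lia]; rewrite big_ltn; [|lia]; rewrite big_nat1.
rewrite entry_head_prodV_diag //; last by lia.
rewrite entry_head_prod1 // entry_head_prodV1 //; last by lia.
rewrite entry_head_prodV2 //; last by lia.
rewrite entry_head_prod2 // entry_head_prod_diag // /tails_on !(index_on i0) //; try lia.
have Ya z : Y a a.+1 z = F (It a) z by apply: entry_fix1; lia.
have Yb z : Y a.+1 a.+2 z = F (It a.+1) z by apply: entry_fix1; lia.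
have Yc z : Y a.+2 a.+3 z = F (It a.+2) z by apply: entry_fix1; lia.
rewrite !(eq_osum1 _ _ Ya) !(eq_osum1 _ _ Yb) !(eq_osum1 _ _ Yc).
rewrite !(eq_osum2 _ _ _ Yb) !(eq_osum2 _ _ _ Yc).
ring.
Qed.

End FixedPoint.
End MilnorSums.

(** * Milnor numbers as signed sums over trees *)

Section MilnorFormulas.
Import GRing.Theory.
Local Open Scope ring_scope.
Variables (n : nat) (G : gauss_diagram n).
Implicit Types (i j k l : 'I_n) (x : arrow G).
Local Notation F := (@tails_on n G).
Local Notation H x := (heads_before (tail_of x)).

(* The sum of the diagrams with root arrow [x], coming from the [i]-th string,
   whose other arrows hang from the heads above the tail of [x]. *)
Definition tree fs i x : int := F i x * osum fs (H x).

Lemma tails_onM i j x : i != j -> F i x * F j x = 0.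
Proof.
move=> ij; rewrite /tails_on; case: eqP => [->|_]; last by rewrite mulr0 mul0r.
by rewrite (negPf ij) mulr0 mulr0.
Qed.

Lemma entry_ord_max p (A : 'M[int]_p.+1) : entry A 0 p = A ord0 ord_max.
Proof.
by rewrite /entry; congr (A _ _); apply: val_inj; rewrite /= inordK.
Qed.

Lemma milnor2 i j k : uniq [:: i; j; k] ->
  milnor G [:: j; k] i =
  osum [:: F j; F k] (heads G i) + osum [:: tree [:: F k] j] (heads G i)
  - osum [:: tree [:: F j] k] (heads G i).
Proof.
rewrite cons_uniq => /andP[iN u_jk].
have [y [y1 yE]] := conj_shift_fixpoint [:: j; k] G.
rewrite (milnor_head_prod y1 yE u_jk iN) -/(heads G i) -entry_ord_max.
rewrite (entry_head_prod2 y1) //.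
rewrite (eq_osum1 _ _ (fun x => entry_fix2 y1 yE u_jk i x (leqnn 2))).
rewrite (eq_osum1 _ _ (fun x => entry_fix1 y1 yE u_jk i x (ltnW (leqnn 2)))).
rewrite (eq_osum2 _ _ _ (fun x => entry_fix1 y1 yE u_jk i x (leqnn 2))) /=.
by rewrite osumD1 osumN1 addrC addrA.
Qed.

(** Eight terms come from [Y 0 3], two from [Y 0 1] with [Y 1 3], two from [Y 0 2] with [Y 2 3], and
    one from three single steps. *)
Lemma milnor3 i j k l : uniq [:: i; j; k; l] ->
  let O fs := osum fs (heads G i) in
  milnor G [:: j; k; l] i =
    O [:: F j; F k; F l] - O [:: F j; tree [:: F k] l]
    + O [:: tree [:: F k; F j] l] + O [:: tree [:: F k] j; F l]
    - O [:: tree [:: tree [:: F k] j] l] - O [:: tree [:: F j] k; F l]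
    + O [:: F j; tree [:: F l] k] - O [:: tree [:: F j; F l] k]
    - O [:: tree [:: F l; F j] k] + O [:: tree [:: tree [:: F j] k] l]
    + O [:: tree [:: F k; F l] j] + O [:: tree [:: tree [:: F l] k] j]
    - O [:: tree [:: tree [:: F k] l] j].
Proof.
rewrite cons_uniq => /andP[iN u_jkl] O.
have [y [y1 yE]] := conj_shift_fixpoint [:: j; k; l] G.
rewrite (milnor_head_prod y1 yE u_jkl iN) -/(heads G i) -entry_ord_max.
rewrite (entry_head_prod3 y1) //.
pose Y := signed_entry y.
have Y01 x : Y 0 1 x = F j x by exact: (entry_fix1 y1 yE u_jkl i).
have Y12 x : Y 1 2 x = F k x by exact: (entry_fix1 y1 yE u_jkl i).
have Y23 x : Y 2 3 x = F l x by exact: (entry_fix1 y1 yE u_jkl i).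
have Y02 x : Y 0 2 x = tree [:: F k] j x - tree [:: F j] k x.
  exact: (entry_fix2 y1 yE u_jkl i).
have Y13 x : Y 1 3 x = tree [:: F l] k x - tree [:: F k] l x.
  exact: (entry_fix2 y1 yE u_jkl i).
have [jk [jl kl]] : (j != k) /\ (j != l) /\ (k != l).
  by move: u_jkl; rewrite /= !inE negb_or => /and3P[/andP[-> ->] ->].
have Y03 x : Y 0 3 x =
    tree [:: F k; F l] j x + tree [:: tree [:: F l] k] j x
    - tree [:: tree [:: F k] l] j x - tree [:: F j; F l] k x
    - tree [:: F l; F j] k x + tree [:: F k; F j] l x
    - tree [:: tree [:: F k] j] l x + tree [:: tree [:: F j] k] l x.
  rewrite {1}/Y (entry_fix3 y1 yE u_jkl i x) //= -/Y.
  (* Both orders of the shuffle survive under the root [k]; under [l] the order [j, k] cancels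
     against the term of the inverse product. *)
  rewrite (eq_osum1 _ _ Y13) (eq_osum1 _ _ Y02) !osumM => [|z|z]; try exact: tails_onM.
  by rewrite !osumD1 !osumN1 /tree; ring.
rewrite (eq_osum1 _ _ Y03) (eq_osum1 _ _ Y01) (eq_osum2 _ _ _ Y13).
rewrite (eq_osum1 _ _ Y02) (eq_osum2 _ _ _ Y23) (eq_osum1 _ _ Y01).
rewrite (eq_osum2 _ _ _ Y12) (eq_osum3 _ _ _ _ Y23).
rewrite !osumD1 !osumN1 !osumD2 !osumN2 /O; ring.
Qed.

End MilnorFormulas.

(** * Pairings with arrow diagrams *)

Section PairingSums.
Import GRing.Theory.
Local Open Scope ring_scope.

(** Splitting off the value at [ord0] matches finite functions with tuples. *)
Lemma sum_ffun_tsum (T : finType) (f : T -> int) k (F : seq T -> int) :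
  \sum_(phi : {ffun 'I_k -> T})
     (\prod_i f (phi i)) * F [seq phi i | i <- enum 'I_k] = tsum (nseq k f) F.
Proof.
elim: k F => [|k IHk] F /=.
  rewrite (big_pred1 (ffun0 (card_ord 0))) => [|phi]; last first.
    by apply/esym/eqP/ffunP => -[].
  by rewrite big_ord0 mul1r enum_ord0.
pose cons_ffun (xp : T * {ffun 'I_k -> T}) : {ffun 'I_k.+1 -> T} :=
  [ffun i => if unlift ord0 i is Some j then xp.2 j else xp.1].
pose uncons (phi : {ffun 'I_k.+1 -> T}) : T * {ffun 'I_k -> T} :=
  (phi ord0, [ffun j => phi (lift ord0 j)]).
rewrite (reindex cons_ffun) /=; last first.
  exists uncons => [[x phi] _|phi _]; last first.
    by apply/ffunP => i; rewrite ffunE; case: unliftP => [j|] -> //; rewrite ffunE.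
  rewrite /uncons ffunE unlift_none /=; congr (_, _).
  by apply/ffunP => j; rewrite !ffunE liftK.
rewrite -(pair_big xpredT xpredT (fun x phi =>
  (\prod_i f (cons_ffun (x, phi) i)) *
  F [seq cons_ffun (x, phi) i | i <- enum 'I_k.+1])) /=.
apply: eq_bigr => x _; rewrite -IHk big_distrr; apply: eq_bigr => phi _ /=.
rewrite big_ord_recl ffunE unlift_none /= mulrA; congr (_ * _ * F _).
  by apply: eq_bigr => i _; rewrite ffunE liftK.
rewrite enum_ordSl /= ffunE unlift_none; congr (_ :: _).
by rewrite -map_comp; apply: eq_map => i /=; rewrite ffunE liftK.
Qed.

Variables (n : nat) (G : gauss_diagram n).
Implicit Types (ps : seq ('I_n * 'I_n)) (t : seq (arrow G)).

(* The endpoints of the diagram [ps], with the strings prescribed by [ps], when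
   its arrows are sent to [t]. *)
Definition placed ps t : seq ('I_n * (arrow G * bool)) :=
  flatten [seq [:: (p.1.1, tail_of p.2); (p.1.2, head_of p.2)] | p <- zip ps t].

Definition fits ps t i : bool :=
  subseq [seq e.2 | e <- placed ps t & e.1 == i] (strand G i).

Lemma map_list_strand ps (phi : 'I_(size ps) -> arrow G) i :
  [seq (phi e.1, e.2) | e <- list_strand ps i] =
  [seq e.2 | e <- placed ps [seq phi k | k <- enum 'I_(size ps)] & e.1 == i].
Proof.
have -> : placed ps [seq phi k | k <- enum 'I_(size ps)] =
    [seq (list_on e, (phi e.1, e.2)) | e <- list_endpoints ps].
  rewrite /placed; have -> : zip ps [seq phi k | k <- enum 'I_(size ps)] =
      [seq (tnth (in_tuple ps) k, phi k) | k <- enum 'I_(size ps)].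
    by rewrite -zip_map (map_tnth_enum (in_tuple ps)).
  rewrite -map_comp /list_endpoints; elim: (enum _) => //= k s IHs.
  by congr [:: _, _ & _].
by rewrite filter_map -map_comp.
Qed.

(** Injectivity is automatic: arrows with the same image join the same strings, hence are the same
    entry of the repetition-free list [ps]. *)
Lemma embedding_arrow_list ps (phi : {ffun 'I_(size ps) -> arrow G}) :
    uniq ps ->
  @embedding n (arrow_list ps) G phi =
  [forall i, fits ps [seq phi k | k <- enum 'I_(size ps)] i].
Proof.
move=> ps_uniq; rewrite /embedding; set E := [forall i, _].
have EE : E = [forall i, fits ps [seq phi k | k <- enum 'I_(size ps)] i].
  by apply: eq_forallb => i; rewrite /= map_list_strand.
rewrite -EE andbC; case: (boolP E) => //= /forallP phiP; apply/injectiveP.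
have on_phi e : on (phi e.1, e.2) = list_on e.
  apply/eqP; rewrite -mem_strand; apply: (mem_subseq (phiP (list_on e))).
  by apply: (map_f (fun e => (phi e.1, e.2))); rewrite mem_list_strand.
move=> k1 k2 phi12; apply/val_inj/eqP.
rewrite -(nth_uniq (tnth (in_tuple ps) k1) _ _ ps_uniq) ?ltn_ord //.
rewrite -!(tnth_nth _ (in_tuple ps)).
have := on_phi (tail_of k1); have := on_phi (head_of k1).
rewrite /= phi12 (on_phi (head_of k2)) (on_phi (tail_of k2)) /list_on /=.
by case: (tnth _ k1) (tnth _ k2) => p1 s1 [p2 s2] /= -> ->.
Qed.

(** A string outside [us] carries no endpoint of the diagram, so its condition concerns an empty
    subsequence. *)
Lemma pairing_arrow_list ps (us : seq 'I_n) :
    uniq ps -> {subset unzip1 ps ++ unzip2 ps <= us} ->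
  pairing1 (arrow_list ps) G =
  tsum (nseq (size ps) (@sign n G)) (fun t => (all (fits ps t) us)%:R).
Proof.
move=> ps_uniq ps_us; rewrite -sum_ffun_tsum /pairing1 big_mkcond.
apply: eq_bigr => phi _; rewrite embedding_arrow_list //.
set t := map _ _.
have -> : [forall i, fits ps t i] = all (fits ps t) us.
  apply/forallP/allP => [fitsP i _|fitsP i]; first exact: fitsP.
  have [/fitsP //|iN] := boolP (i \in us); rewrite /fits.
  rewrite (_ : [seq e <- _ | _] = [::]) ?sub0seq //.
  apply/eqP; rewrite -[_ == _]negbK -has_filter; apply/hasPn => e.
  case/flattenP => _ /mapP[[ps1 x] /= pst ->].
  have {pst} ps1P : ps1 \in ps.
    suff : ps1 \in unzip1 (zip ps t).
      by rewrite unzip1_zip // size_map -cardE card_ord.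
    by apply/mapP; exists (ps1, x).
  have [p1P p2P] : ps1.1 \in us /\ ps1.2 \in us.
    by split; apply: ps_us; rewrite mem_cat map_f ?orbT.
  rewrite !inE => /orP[] /eqP -> /=; apply: contraNneq iN => <- //.
by case: all; rewrite ?mulr1 ?mulr0.
Qed.

Lemma subseq_heads t (st : seq (arrow G * bool)) :
  subseq [seq head_of x | x <- t] st = subseq t [seq e.1 | e <- st & e.2].
Proof.
have headsE : [seq head_of x | x <- [seq e.1 | e <- st & e.2]] =
              [seq e <- st | e.2].
  rewrite -map_comp -[RHS]map_id; apply/eq_in_map => -[a b].
  by rewrite mem_filter => /andP[/= -> _].
apply/idP/idP => [t_st|/(map_subseq (@head_of _))]; last first.
  by rewrite headsE subseq_filter => /andP[].
have : subseq [seq head_of x | x <- t] [seq e <- st | e.2].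
  by rewrite subseq_filter t_st andbT all_map; apply/allP.
by move/(map_subseq fst); rewrite -map_comp map_id.
Qed.

(** After reversal [e] comes first; the entries of [v] are skipped and [e] is matched at the
    displayed occurrence. *)
Lemma subseq_rcons_uniq (T : eqType) (s u v : seq T) e : e \notin v ->
  subseq (rcons s e) (u ++ e :: v) = subseq s u.
Proof.
rewrite -[LHS]subseq_rev -[RHS]subseq_rev rev_rcons rev_cat rev_cons cat_rcons.
rewrite -mem_rev; elim: (rev v) => [_|z w IHw] /=; first by rewrite eqxx.
by rewrite inE negb_or => /andP[/negPf -> /IHw].
Qed.

(** In the diagrams of the formulas each string except the root string carries some heads followed
    by one tail; this is the condition for placing them. *)
Lemma subseq_heads_tail t x i :
  subseq (rcons [seq head_of z | z <- t] (tail_of x)) (strand G i) =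
  (on (tail_of x) == i) && subseq t (heads_before (tail_of x)).
Proof.
case: eqP => /= [<-|/eqP xi]; last first.
  apply/negP => /mem_subseq/(_ (tail_of x)).
  by rewrite mem_rcons mem_head mem_strand (negPf xi) => /(_ isT).
set e := tail_of x; have e_st : e \in strand G (on e) by rewrite mem_strand.
have := strand_uniq G (on e); rewrite /heads_before.
case/splitPr: e_st => u v; rewrite cat_uniq => /and3P[_ uv /= /andP[ev _]].
have eu : e \notin u.
  by apply: contra uv => eu; apply/hasP; exists e; rewrite ?mem_head.
rewrite subseq_rcons_uniq // index_cat (negPf eu) /= eqxx addn0 take_size_cat //.
exact: subseq_heads.
Qed.

End PairingSums.

(** * Ordered sums as plain multiple sums *)

Section FlatSums.
Import GRing.Theory.
Local Open Scope ring_scope.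
Variable T : finType.
Implicit Types (f g h : T -> int) (s : seq T).

Lemma tsum2E f g (Phi : seq T -> int) :
  tsum [:: f; g] Phi = \sum_x \sum_y f x * g y * Phi [:: x; y].
Proof.
rewrite /=; apply: eq_bigr => x _; rewrite big_distrr; apply: eq_bigr => y _.
exact: mulrA.
Qed.

Lemma tsum3E f g h (Phi : seq T -> int) :
  tsum [:: f; g; h] Phi =
  \sum_x \sum_y \sum_z f x * g y * h z * Phi [:: x; y; z].
Proof.
rewrite /=; apply: eq_bigr => x _; rewrite big_distrr; apply: eq_bigr => y _.
rewrite !big_distrr; apply: eq_bigr => z _ /=; ring.
Qed.

Lemma osum1E f s : uniq s -> osum [:: f] s = \sum_x f x * (x \in s)%:R.
Proof. by move/tsum_subseq <-; apply: eq_bigr => x _; rewrite /= -sub1seq. Qed.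

Lemma osum2E f g s : uniq s ->
  osum [:: f; g] s = \sum_x \sum_y f x * g y * (subseq [:: x; y] s)%:R.
Proof. by move/tsum_subseq <-; apply: tsum2E. Qed.

Lemma osum3E f g h s : uniq s ->
  osum [:: f; g; h] s =
  \sum_x \sum_y \sum_z f x * g y * h z * (subseq [:: x; y; z] s)%:R.
Proof. by move/tsum_subseq <-; apply: tsum3E. Qed.

End FlatSums.

(** * The diagram shapes and their tree sums *)

Section Shapes.
Import GRing.Theory.
Local Open Scope ring_scope.
Variables (n : nat) (G : gauss_diagram n).
Implicit Types (j a b c : 'I_n) (x y z : arrow G).
Local Notation F := (@tails_on n G).
Local Notation H x := (heads_before (tail_of x)).
Local Notation "''t_' a x" := (on (tail_of x) == a)
  (at level 0, a at level 2, x at level 9).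

Lemma heads_only_uniq (st : seq (arrow G * bool)) :
  uniq st -> uniq [seq e.1 | e <- st & e.2].
Proof.
move=> st_uniq; rewrite map_inj_in_uniq ?filter_uniq // => -[x p] [y q].
by rewrite !mem_filter /= => /andP[-> _] /andP[-> _] ->.
Qed.

Lemma heads_uniq j : uniq (heads G j).
Proof. exact/heads_only_uniq/strand_uniq. Qed.

Lemma heads_before_uniq e : uniq (@heads_before n G e).
Proof. exact/heads_only_uniq/take_uniq/strand_uniq. Qed.

Lemma strand_heads1 x j : subseq [:: head_of x] (strand G j) = (x \in heads G j).
Proof. by rewrite (subseq_heads [:: x]) sub1seq. Qed.

Lemma strand_heads2 x y j :
  subseq [:: head_of x; head_of y] (strand G j) = subseq [:: x; y] (heads G j).
Proof. exact: (subseq_heads [:: x; y]). Qed.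

Lemma strand_heads3 x y z j :
  subseq [:: head_of x; head_of y; head_of z] (strand G j) =
  subseq [:: x; y; z] (heads G j).
Proof. exact: (subseq_heads [:: x; y; z]). Qed.

Lemma strand_tail0 x j : subseq [:: tail_of x] (strand G j) = 't_j x.
Proof. by rewrite (subseq_heads_tail [::]) sub0seq andbT. Qed.

Lemma strand_tail1 x y j :
  subseq [:: head_of y; tail_of x] (strand G j) = 't_j x && (y \in H x).
Proof. by rewrite (subseq_heads_tail [:: y]) sub1seq. Qed.

Lemma strand_tail2 x y z j :
  subseq [:: head_of y; head_of z; tail_of x] (strand G j) =
  't_j x && subseq [:: y; z] (H x).
Proof. exact: (subseq_heads_tail [:: y; z]). Qed.

Definition strandE := (strand_heads1, strand_heads2, strand_heads3,
  strand_tail0, strand_tail1, strand_tail2).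

(** All comparisons between the four strings at once, so that a single rewrite evaluates every
    filter by string. *)
Lemma uniq4 j a b c : uniq [:: j; a; b; c] ->
  ((((j == a) = false) * ((j == b) = false) * ((j == c) = false)) *
  (((a == b) = false) * ((a == c) = false) * ((b == c) = false)) *
  (((a == j) = false) * ((b == j) = false) * ((c == j) = false)) *
  (((b == a) = false) * ((c == a) = false) * ((c == b) = false)))%type.
Proof.
rewrite /= !inE !negb_or andbT.
case/and3P=> /and3P[/negPf ja /negPf jb /negPf jc].
move=> /andP[/negPf ab /negPf ac] /negPf bc.
by do !split; rewrite // eq_sym.
Qed.

Lemma pairing_three j a b c : uniq [:: j; a; b; c] ->
  pairing1 (arrow_list [:: (a, j); (b, j); (c, j)]) G =
  osum [:: F a; F b; F c] (heads G j).
Proof.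
move=> u; rewrite (pairing_arrow_list G (us := [:: j; a; b; c])); last 2 first.
- by rewrite /= !inE !xpair_eqE !(uniq4 u).
- by apply/allP; rewrite /= !inE !eqxx ?orbT.
rewrite tsum3E osum3E ?heads_uniq //.
do 3!(apply: eq_bigr => ? _).
rewrite /fits /placed /= !(eqxx, uniq4 u) /= !strandE /tails_on.
rewrite !andbT -!mulnb !natrM; ring.
Qed.

Lemma pairing_tree_first j a b c : uniq [:: j; a; b; c] ->
  pairing1 (arrow_list [:: (b, a); (a, j); (c, j)]) G =
  osum [:: tree [:: F b] a; F c] (heads G j).
Proof.
move=> u; rewrite (pairing_arrow_list G (us := [:: j; a; b; c])); last 2 first.
- by rewrite /= !inE !xpair_eqE !(uniq4 u).
- by apply/allP; rewrite /= !inE !eqxx ?orbT.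
rewrite tsum3E osum2E ?heads_uniq // exchange_big; apply: eq_bigr => y _.
rewrite exchange_big; apply: eq_bigr => z _.
rewrite /tree osum1E ?heads_before_uniq // -mulrA mulrAC big_distrr.
apply: eq_bigr => x _.
rewrite /fits /placed /= !(eqxx, uniq4 u) /= !strandE /tails_on.
rewrite !andbT -!mulnb !natrM; ring.
Qed.

(** The arrows [a -> j] and [c -> b] share no string, so their listed order imposes nothing. *)
Lemma pairing_tree_last j a b c : uniq [:: j; a; b; c] ->
  pairing1 (arrow_list [:: (a, j); (c, b); (b, j)]) G =
  osum [:: F a; tree [:: F c] b] (heads G j).
Proof.
move=> u; rewrite (pairing_arrow_list G (us := [:: j; a; b; c])); last 2 first.
- by rewrite /= !inE !xpair_eqE !(uniq4 u).
- by apply/allP; rewrite /= !inE !eqxx ?orbT.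
rewrite tsum3E osum2E ?heads_uniq //; apply: eq_bigr => x _.
rewrite exchange_big; apply: eq_bigr => z _.
rewrite /tree osum1E ?heads_before_uniq // mulrA mulrAC big_distrr.
apply: eq_bigr => y _.
rewrite /fits /placed /= !(eqxx, uniq4 u) /= !strandE /tails_on.
rewrite !andbT -!mulnb !natrM; ring.
Qed.

Lemma pairing_cherry j a b c : uniq [:: j; a; b; c] ->
  pairing1 (arrow_list [:: (b, a); (c, a); (a, j)]) G =
  osum [:: tree [:: F b; F c] a] (heads G j).
Proof.
move=> u; rewrite (pairing_arrow_list G (us := [:: j; a; b; c])); last 2 first.
- by rewrite /= !inE !xpair_eqE !(uniq4 u).
- by apply/allP; rewrite /= !inE !eqxx ?orbT.
rewrite tsum3E osum1E ?heads_uniq //.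
under eq_bigr do rewrite exchange_big; rewrite exchange_big.
apply: eq_bigr => z _; rewrite /tree osum2E ?heads_before_uniq // mulrAC.
rewrite big_distrr; apply: eq_bigr => x _; rewrite big_distrr.
apply: eq_bigr => y _.
rewrite /fits /placed /= !(eqxx, uniq4 u) /= !strandE /tails_on.
rewrite !andbT -!mulnb !natrM; ring.
Qed.

(** The list runs from leaf to root and the nested sums from root to leaf, so the summations are
    reversed. *)
Lemma pairing_chain j a b c : uniq [:: j; a; b; c] ->
  pairing1 (arrow_list [:: (c, b); (b, a); (a, j)]) G =
  osum [:: tree [:: tree [:: F c] b] a] (heads G j).
Proof.
move=> u; rewrite (pairing_arrow_list G (us := [:: j; a; b; c])); last 2 first.
- by rewrite /= !inE !xpair_eqE !(uniq4 u).
- by apply/allP; rewrite /= !inE !eqxx ?orbT.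
rewrite tsum3E osum1E ?heads_uniq // exchange_big.
under eq_bigr do rewrite exchange_big; rewrite exchange_big.
apply: eq_bigr => z _; rewrite /tree osum1E ?heads_before_uniq // mulrAC.
rewrite big_distrr; apply: eq_bigr => y _ /=.
rewrite osum1E ?heads_before_uniq // (mulrAC (F b y)) mulrA big_distrr /=.
apply: eq_bigr => x _.
rewrite /fits /placed /= !(eqxx, uniq4 u) /= !strandE /tails_on.
rewrite !andbT -!mulnb !natrM; ring.
Qed.

Lemma uniq3 j a b : uniq [:: j; a; b] ->
  (((j == a) = false) * ((j == b) = false) * ((a == b) = false) *
  (((a == j) = false) * ((b == j) = false) * ((b == a) = false)))%type.
Proof.
rewrite /= !inE negb_or andbT => /andP[/andP[/negPf ja /negPf jb] /negPf ab].
by do !split; rewrite // eq_sym.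
Qed.

Lemma pairing_two j a b : uniq [:: j; a; b] ->
  pairing1 (arrow_list [:: (a, j); (b, j)]) G = osum [:: F a; F b] (heads G j).
Proof.
move=> u; rewrite (pairing_arrow_list G (us := [:: j; a; b])); last 2 first.
- by rewrite /= !inE !xpair_eqE !(uniq3 u).
- by apply/allP; rewrite /= !inE !eqxx ?orbT.
rewrite tsum2E osum2E ?heads_uniq //; do 2!(apply: eq_bigr => ? _).
rewrite /fits /placed /= !(eqxx, uniq3 u) /= !strandE /tails_on.
rewrite !andbT -!mulnb !natrM; ring.
Qed.

Lemma pairing_edge j a b : uniq [:: j; a; b] ->
  pairing1 (arrow_list [:: (b, a); (a, j)]) G =
  osum [:: tree [:: F b] a] (heads G j).
Proof.
move=> u; rewrite (pairing_arrow_list G (us := [:: j; a; b])); last 2 first.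
- by rewrite /= !inE !xpair_eqE !(uniq3 u).
- by apply/allP; rewrite /= !inE !eqxx ?orbT.
rewrite tsum2E osum1E ?heads_uniq // exchange_big; apply: eq_bigr => y _.
rewrite /tree osum1E ?heads_before_uniq // mulrAC big_distrr.
apply: eq_bigr => x _.
rewrite /fits /placed /= !(eqxx, uniq3 u) /= !strandE /tails_on.
rewrite !andbT -!mulnb !natrM; ring.
Qed.

End Shapes.

Theorem corollary4p7 :
  (forall G : gauss_diagram 3,
     milnor G [:: string 2; string 3] (string 1) =
     pairing
       [:: (1%R, diagram [:: (3, 2); (2, 1)]);
           (1%R, diagram [:: (2, 1); (3, 1)]);
           ((-1)%R, diagram [:: (2, 3); (3, 1)])] G)
  /\
  (forall G : gauss_diagram 4,
     milnor G [:: string 2; string 3; string 4] (string 1) =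
     pairing
       [:: (1%R, diagram [:: (2, 1); (3, 1); (4, 1)]);
           ((-1)%R, diagram [:: (2, 1); (3, 4); (4, 1)]);
           (1%R, diagram [:: (3, 4); (2, 4); (4, 1)]);
           (1%R, diagram [:: (3, 2); (2, 1); (4, 1)]);
           ((-1)%R, diagram [:: (3, 2); (2, 4); (4, 1)]);
           ((-1)%R, diagram [:: (2, 3); (3, 1); (4, 1)]);
           (1%R, diagram [:: (2, 1); (4, 3); (3, 1)]);
           ((-1)%R, diagram [:: (2, 3); (4, 3); (3, 1)]);
           ((-1)%R, diagram [:: (4, 3); (2, 3); (3, 1)]);
           (1%R, diagram [:: (2, 3); (3, 4); (4, 1)]);
           (1%R, diagram [:: (3, 2); (4, 2); (2, 1)]);
           (1%R, diagram [:: (4, 3); (3, 2); (2, 1)]);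
           ((-1)%R, diagram [:: (3, 4); (4, 2); (2, 1)])] G).
Proof.
(* On the predecessors of [1, ..., m + 1], [inord] is injective. *)
have strings_uniq m (s : seq nat) : all (fun k => 0 < k <= m.+1) s -> uniq s ->
    uniq [seq (string k : 'I_m.+1) | k <- s].
  move=> /allP s_le s_uniq; rewrite map_inj_in_uniq // => k l /s_le k_le /s_le l_le.
  by move/(congr1 val); rewrite /= !inordK; lia.
split=> G; rewrite /pairing !big_cons big_nil /= ?GRing.mul1r ?GRing.mulN1r.
  have u k l m := strings_uniq 2 [:: k; l; m].
  rewrite milnor2 ?u // /diagram /= pairing_two ?u // !pairing_edge ?u //.
  ring.
have u k l m p := strings_uniq 3 [:: k; l; m; p].
(* Each of the thirteen diagrams has one of five shapes, so both sides become the same signed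
   sums. *)
rewrite milnor3 ?u // /diagram /= pairing_three ?u // !pairing_tree_first ?u //.
rewrite !pairing_tree_last ?u // !pairing_cherry ?u // !pairing_chain ?u //.
ring.
Qed.
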